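(* Let $G$ be a 2-connected graph. Then $G$ is not $(4,2)$-choosable unless either (i) $G$ is isomorphic to one of $C_{2s}$, $\theta_{2,2s,2t}$, $\theta_{1,2s+1,2t+1}$ (for some positive integers $s,t$), or $\theta_{2,2,2,2}$, or (ii) $G$ is formed from $K_{3,3}-e$ by repeatedly subdividing a single edge incident to a vertex of degree 2.
   Context: Graphs are finite and simple. 2-connected means connected, at least three vertices, and no cut-vertex. A graph $G$ is $(4,2)$-choosable if for every assignment $L$ of a set $L(v)$ of exactly 4 colors to each vertex $v$, there is $\varphi$ with $\varphi(v)\subseteq L(v)$, $|\varphi(v)|=2$ for all $v$, and $\varphi(x)\cap\varphi(y)=\emptyset$ for all edges $xy$. $\theta_{a,b,c}$ (resp. $\theta_{a,b,c,d}$) is the graph formed from three (resp. four) internally vertex-disjoint paths of the given lengths sharing the same two endpoints. $K_{3,3}-e$ is $K_{3,3}$ with one edge deleted. *)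

(* Defs.v *)
(* Plain MathComp.  A finite simple graph is a symmetric irreflexive relation
   [e : rel V] on a [V : finType]. *)
From mathcomp Require Import all_boot.

Set Implicit Arguments.
Unset Strict Implicit.
Unset Printing Implicit Defensive.

Definition isomorphic (V W : finType) (e : rel V) (e' : rel W) : Prop :=
  exists2 f : V -> W, bijective f & forall x y, e' (f x) (f y) = e x y.

Definition connected_graph (V : finType) (e : rel V) : Prop :=
  forall x y : V, connect e x y.

Definition delete_vertex (V : finType) (e : rel V) (v : V) : rel V :=
  [rel x y | [&& x != v, y != v & e x y]].

(* [v] separates two other vertices of its component. *)
Definition cut_vertex (V : finType) (e : rel V) (v : V) : Prop :=
  exists x y : V, [/\ x != v, y != v, connect e x y
                    & ~~ connect (delete_vertex e v) x y].

Definition two_connected (V : finType) (e : rel V) : Prop :=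
  [/\ connected_graph e, 2 < #|V| & forall v : V, ~ cut_vertex e v].

(* The palette [C] ranges over all finite types; as the graph is finite, this
   covers lists drawn from any set of colors. *)
Definition choosable (a b : nat) (V : finType) (e : rel V) : Prop :=
  forall (C : finType) (L : V -> {set C}),
    (forall v, #|L v| = a) ->
    exists phi : V -> {set C},
      (forall v, phi v \subset L v /\ #|phi v| = b) /\
      (forall x y, e x y -> [disjoint phi x & phi y]).

Definition degree (V : finType) (e : rel V) (v : V) : nat := #|[set w | e v w]|.

(* A cycle in the usual sense only for [3 <= n]; for [n = 2] this is a single
   edge. *)
Definition cycle_graph (n : nat) : rel 'I_n :=
  [rel i j | (j == ordS i) || (i == ordS j)].
Arguments cycle_graph n : clear implicits.

(* The theta graph with list of path lengths [s]: [inl false] and [inl true]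
   are the two common endpoints, and [inr (Tagged _ k)] with tag [i] is the
   vertex at distance [k.+1] from [inl false] along the [i]-th path. *)
Definition theta_vertex (s : seq nat) : finType :=
  (bool + {i : 'I_(size s) & 'I_(nth 0 s i).-1})%type.

(* [x] is the [j]-th vertex of the [i]-th path, counting from [0]. *)
Definition theta_at (s : seq nat) (i : 'I_(size s)) (j : nat)
    (x : theta_vertex s) : bool :=
  match x with
  | inl b => j == (if b then nth 0 s i else 0)
  | inr p => (tag p == i) && (j == (tagged p).+1)
  end.

Definition theta_graph (s : seq nat) : rel (theta_vertex s) :=
  [rel x y | [exists i : 'I_(size s), exists j : 'I_(nth 0 s i),
     (theta_at i j x && theta_at i j.+1 y) ||
     (theta_at i j y && theta_at i j.+1 x)]].
Arguments theta_graph s : clear implicits.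

Definition delete_edge (V : finType) (e : rel V) (u v : V) : rel V :=
  [rel x y | e x y && ~~ (((x == u) && (y == v)) || ((x == v) && (y == u)))].

(* [x] is the [j]-th vertex of the path u, 0, 1, ..., k - 1, v whose [k]
   internal vertices are new. *)
Definition subdivided_at (V : finType) (u v : V) (k j : nat)
    (x : V + 'I_k) : bool :=
  match x with
  | inl w => ((j == 0) && (w == u)) || ((j == k.+1) && (w == v))
  | inr i => j == i.+1
  end.

(* The edge [u v] of [e] subdivided [k] times, i.e. replaced by a path of
   length [k.+1]; for [k = 0] the graph is unchanged. *)
Definition subdivide_edge (V : finType) (e : rel V) (u v : V) (k : nat) :
    rel (V + 'I_k)%type :=
  [rel x y |
     match x, y with
     | inl a, inl b => delete_edge e u v a b
     | _, _ => false
     end ||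
     [exists j : 'I_k.+1,
        (subdivided_at u v j x && subdivided_at u v j.+1 y) ||
        (subdivided_at u v j y && subdivided_at u v j.+1 x)]].
Arguments subdivide_edge {V} e u v k.

Definition K33 : rel (bool * 'I_3) := [rel x y | x.1 != y.1].

Definition K33_minus_edge : rel (bool * 'I_3) :=
  delete_edge K33 (false, ord0) (true, ord0).

(* Main.v *)
Require Import Defs.
From mathcomp Require Import all_boot.
From mathcomp Require Import zify.

(* Constant lists show that a choosable graph is bipartite.  Subdividing an edge
   twice preserves non-choosability: give both new vertices the list of the
   neighbouring end, which forces the second one to repeat the colors of that
   end.  So it suffices to exhibit bad list assignments for finitely many small
   graphs, and every subdivision of one of them with the same parities of path
   lengths is bad too.

   A 2-connected graph is built from a cycle by adding ears.  The bad thetas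
   force each theta subgraph to have a path of length at most 2.  An ear on a
   theta with both ends on one path is always bad; an ear between the two branch
   vertices leaves only K_{2,4}; an ear between inner vertices of different
   paths gives a subdivided K_4, where only K_{3,3} - e with a subdivided edge at
   a vertex of degree 2 survives.  An ear added to either survivor creates one of
   the previous bad configurations, K_{2,5} or K_{3,3}. *)

Set Implicit Arguments.
Unset Strict Implicit.
Unset Printing Implicit Defensive.

(** * Finite list assignments and the test that they admit no coloring *)

(* A list assignment on a subdivided multigraph: the lists of the branch vertices
   0, 1, ..., and for each edge its two ends and the lists of its inner vertices
   in order. *)
Definition certificate : Type :=
  (seq (seq nat) * seq (nat * nat * seq (seq nat)))%type.

Definition pair_disjoint (P Q : nat * nat) : bool :=
  [&& P.1 != Q.1, P.1 != Q.2, P.2 != Q.1 & P.2 != Q.2].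

Definition color_pairs (l : seq nat) : seq (nat * nat) :=
  [seq P <- [seq (a, b) | a <- l, b <- l] | P.1 < P.2].

(** Decides whether a path whose inner vertices have lists [ls] can be colored between the end pairs
    [P] and [Q]; two-element sets are kept as increasing pairs. *)
Fixpoint extends (P : nat * nat) (ls : seq (seq nat)) (Q : nat * nat) : bool :=
  if ls is l :: ls' then
    has (fun P' => pair_disjoint P P' && extends P' ls' Q) (color_pairs l)
  else pair_disjoint P Q.

Fixpoint choices (T : Type) (s : seq (seq T)) : seq (seq T) :=
  if s is l :: s' then [seq x :: t | x <- l, t <- choices s'] else [:: [::]].

Definition respects (A : seq (nat * nat)) (c : nat * nat * seq (seq nat)) :=
  let: (i, j, ls) := c in extends (nth (0, 0) A i) ls (nth (0, 0) A j).

(** The bound 7 lets the single palette ['I_7] serve every certificate. *)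
Definition is_list (l : seq nat) : bool :=
  [&& uniq l, size l == 4 & all (fun a => a < 7) l].

(** Only the pairs at branch vertices are enumerated, at most 6 for each; the inner vertices of each
    edge are treated separately by [extends], which keeps the computation small. *)
Definition uncolorable (ct : certificate) : bool :=
  [&& all is_list ct.1,
      all (fun c => (c.1.1 < size ct.1) && (c.1.2 < size ct.1) && all is_list c.2) ct.2
    & all (fun A => ~~ all (respects A) ct.2) (choices (map color_pairs ct.1))].

(** * The bad list assignments *)

(* Digits in a name are path lengths, in the order of the listed edges.  In [fat]
   two cycles share branch vertex 0 and in [dbl] two disjoint cycles are joined by
   two paths.  All lists were found by computer search. *)
Definition theta333 : certificate :=
  ([:: [:: 1; 3; 4; 5]; [:: 1; 3; 4; 5]],
   [:: (0, 1, [:: [:: 1; 2; 4; 5]; [:: 1; 2; 3; 5]]);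
       (0, 1, [:: [:: 0; 3; 4; 5]; [:: 0; 1; 4; 5]]);
       (0, 1, [:: [:: 0; 1; 2; 3]; [:: 0; 2; 3; 4]])]).

Lemma theta333P : uncolorable theta333. Proof. by vm_compute. Qed.

Definition theta444 : certificate :=
  ([:: [:: 0; 1; 2; 4]; [:: 0; 1; 2; 4]],
   [:: (0, 1, [:: [:: 0; 1; 2; 4]; [:: 0; 1; 3; 4]; [:: 0; 1; 2; 3]]);
       (0, 1, [:: [:: 1; 2; 3; 4]; [:: 0; 1; 2; 3]; [:: 0; 1; 2; 4]]);
       (0, 1, [:: [:: 0; 1; 3; 4]; [:: 1; 2; 3; 4]; [:: 0; 1; 2; 4]])]).

Lemma theta444P : uncolorable theta444. Proof. by vm_compute. Qed.

Definition theta2224 : certificate :=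
  ([:: [:: 0; 1; 2; 4]; [:: 1; 2; 3; 5]],
   [:: (0, 1, [:: [:: 0; 1; 3; 4]]);
       (0, 1, [:: [:: 0; 1; 2; 5]]);
       (0, 1, [:: [:: 1; 2; 4; 5]]);
       (0, 1, [:: [:: 0; 1; 2; 3]; [:: 0; 3; 4; 5]; [:: 2; 3; 4; 5]])]).

Lemma theta2224P : uncolorable theta2224. Proof. by vm_compute. Qed.

Definition theta22222 : certificate :=
  ([:: [:: 1; 2; 3; 4]; [:: 0; 3; 5; 6]],
   [:: (0, 1, [:: [:: 2; 3; 4; 5]]);
       (0, 1, [:: [:: 1; 3; 4; 6]]);
       (0, 1, [:: [:: 0; 1; 3; 5]]);
       (0, 1, [:: [:: 1; 2; 3; 6]]);
       (0, 1, [:: [:: 0; 2; 3; 4]])]).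

Lemma theta22222P : uncolorable theta22222. Proof. by vm_compute. Qed.

Definition K4_111222 : certificate :=
  ([:: [:: 0; 3; 5; 6]; [:: 0; 2; 5; 6]; [:: 1; 3; 5; 6]; [:: 0; 3; 4; 5]],
   [:: (0, 1, [::]);
       (0, 2, [::]);
       (0, 3, [::]);
       (1, 2, [:: [:: 1; 2; 3; 5]]);
       (1, 3, [:: [:: 2; 4; 5; 6]]);
       (2, 3, [:: [:: 0; 1; 4; 5]])]).

Lemma K4_111222P : uncolorable K4_111222. Proof. by vm_compute. Qed.

Definition K4_111144 : certificate :=
  ([:: [:: 1; 2; 3; 4]; [:: 0; 1; 2; 4]; [:: 0; 2; 3; 4]; [:: 1; 2; 3; 4]],
   [:: (0, 2, [::]);
       (0, 3, [::]);
       (1, 2, [::]);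
       (1, 3, [::]);
       (0, 1, [:: [:: 0; 1; 2; 3]; [:: 0; 2; 3; 5]; [:: 0; 1; 2; 5]]);
       (2, 3, [:: [:: 0; 2; 3; 4]; [:: 0; 1; 2; 4]; [:: 0; 1; 2; 3]])]).

Lemma K4_111144P : uncolorable K4_111144. Proof. by vm_compute. Qed.

Definition K4_222222 : certificate :=
  ([:: [:: 2; 3; 4; 5]; [:: 0; 2; 3; 4]; [:: 0; 1; 4; 5]; [:: 0; 2; 4; 5]],
   [:: (0, 1, [:: [:: 0; 3; 4; 5]]);
       (0, 2, [:: [:: 0; 2; 4; 5]]);
       (0, 3, [:: [:: 2; 3; 4; 5]]);
       (1, 2, [:: [:: 1; 2; 4; 5]]);
       (1, 3, [:: [:: 0; 2; 3; 4]]);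
       (2, 3, [:: [:: 0; 1; 2; 4]])]).

Lemma K4_222222P : uncolorable K4_222222. Proof. by vm_compute. Qed.

Definition K33_cert : certificate :=
  ([:: [:: 0; 1; 2; 4]; [:: 0; 1; 3; 4]; [:: 1; 2; 3; 5]; [:: 0; 1; 4; 5]; [:: 0; 1; 2; 3]; [:: 1; 2; 3; 4]],
   [:: (0, 3, [::]);
       (0, 4, [::]);
       (0, 5, [::]);
       (1, 3, [::]);
       (1, 4, [::]);
       (1, 5, [::]);
       (2, 3, [::]);
       (2, 4, [::]);
       (2, 5, [::])]).

Lemma K33_certP : uncolorable K33_cert. Proof. by vm_compute. Qed.

Definition fat13132 : certificate :=
  ([:: [:: 0; 1; 2; 3]; [:: 0; 2; 3; 5]; [:: 0; 1; 2; 3]],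
   [:: (0, 1, [::]);
       (0, 1, [:: [:: 0; 1; 3; 4]; [:: 0; 2; 4; 5]]);
       (0, 2, [::]);
       (0, 2, [:: [:: 0; 1; 2; 4]; [:: 0; 2; 3; 4]]);
       (1, 2, [:: [:: 0; 1; 3; 5]])]).

Lemma fat13132P : uncolorable fat13132. Proof. by vm_compute. Qed.

Definition fat13221 : certificate :=
  ([:: [:: 0; 1; 3; 4]; [:: 0; 1; 4; 5]; [:: 0; 2; 4; 5]],
   [:: (0, 1, [::]);
       (0, 1, [:: [:: 0; 2; 3; 4]; [:: 1; 2; 4; 5]]);
       (0, 2, [:: [:: 2; 3; 4; 5]]);
       (0, 2, [:: [:: 0; 1; 2; 4]]);
       (1, 2, [::])]).

Lemma fat13221P : uncolorable fat13221. Proof. by vm_compute. Qed.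

Definition fat22222 : certificate :=
  ([:: [:: 0; 1; 3; 4]; [:: 2; 3; 4; 5]; [:: 0; 1; 2; 5]],
   [:: (0, 1, [:: [:: 0; 2; 4; 5]]);
       (0, 1, [:: [:: 1; 2; 3; 4]]);
       (0, 2, [:: [:: 1; 2; 4; 5]]);
       (0, 2, [:: [:: 0; 2; 3; 4]]);
       (1, 2, [:: [:: 0; 1; 3; 5]])]).

Lemma fat22222P : uncolorable fat22222. Proof. by vm_compute. Qed.

Definition dbl131113 : certificate :=
  ([:: [:: 0; 3; 4; 5]; [:: 0; 1; 4; 5]; [:: 1; 2; 3; 4]; [:: 1; 2; 4; 5]],
   [:: (0, 1, [::]);
       (0, 1, [:: [:: 2; 3; 4; 5]; [:: 0; 1; 2; 4]]);
       (0, 2, [::]);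
       (1, 3, [::]);
       (2, 3, [::]);
       (2, 3, [:: [:: 0; 1; 3; 4]; [:: 0; 2; 4; 5]])]).

Lemma dbl131113P : uncolorable dbl131113. Proof. by vm_compute. Qed.

Definition dbl132213 : certificate :=
  ([:: [:: 0; 2; 3; 4]; [:: 0; 2; 3; 4]; [:: 1; 2; 3; 4]; [:: 2; 3; 4; 5]],
   [:: (0, 1, [::]);
       (0, 1, [:: [:: 0; 1; 2; 3]; [:: 0; 1; 2; 4]]);
       (0, 2, [:: [:: 0; 1; 2; 4]]);
       (1, 3, [:: [:: 0; 2; 3; 5]]);
       (2, 3, [::]);
       (2, 3, [:: [:: 0; 1; 2; 3]; [:: 0; 2; 4; 5]])]).

Lemma dbl132213P : uncolorable dbl132213. Proof. by vm_compute. Qed.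

Definition dbl131222 : certificate :=
  ([:: [:: 1; 2; 4; 5]; [:: 0; 2; 4; 5]; [:: 1; 2; 3; 4]; [:: 1; 2; 4; 5]],
   [:: (0, 1, [::]);
       (0, 1, [:: [:: 1; 2; 3; 5]; [:: 0; 2; 3; 4]]);
       (0, 2, [::]);
       (1, 3, [:: [:: 0; 1; 2; 5]]);
       (2, 3, [:: [:: 1; 2; 3; 4]]);
       (2, 3, [:: [:: 2; 3; 4; 5]])]).

Lemma dbl131222P : uncolorable dbl131222. Proof. by vm_compute. Qed.

Definition dbl132122 : certificate :=
  ([:: [:: 0; 1; 2; 5]; [:: 0; 2; 4; 5]; [:: 0; 2; 3; 4]; [:: 0; 1; 4; 5]],
   [:: (0, 1, [::]);
       (0, 1, [:: [:: 0; 1; 3; 5]; [:: 2; 3; 4; 5]]);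
       (0, 2, [:: [:: 0; 1; 2; 4]]);
       (1, 3, [::]);
       (2, 3, [:: [:: 0; 1; 2; 3]]);
       (2, 3, [:: [:: 1; 3; 4; 5]])]).

Lemma dbl132122P : uncolorable dbl132122. Proof. by vm_compute. Qed.

Definition dbl221122 : certificate :=
  ([:: [:: 0; 1; 2; 3]; [:: 0; 2; 3; 4]; [:: 0; 1; 2; 3]; [:: 0; 2; 3; 4]],
   [:: (0, 1, [:: [:: 0; 1; 2; 4]]);
       (0, 1, [:: [:: 0; 1; 3; 4]]);
       (0, 2, [::]);
       (1, 3, [::]);
       (2, 3, [:: [:: 0; 1; 2; 4]]);
       (2, 3, [:: [:: 0; 1; 3; 4]])]).

Lemma dbl221122P : uncolorable dbl221122. Proof. by vm_compute. Qed.

Definition dbl222222 : certificate :=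
  ([:: [:: 2; 3; 4; 5]; [:: 0; 1; 4; 5]; [:: 2; 3; 4; 5]; [:: 0; 1; 2; 3]],
   [:: (0, 1, [:: [:: 1; 2; 3; 5]]);
       (0, 1, [:: [:: 0; 1; 2; 4]]);
       (0, 2, [:: [:: 2; 3; 4; 5]]);
       (1, 3, [:: [:: 0; 3; 4; 5]]);
       (2, 3, [:: [:: 1; 2; 3; 4]]);
       (2, 3, [:: [:: 0; 1; 2; 5]])]).

Lemma dbl222222P : uncolorable dbl222222. Proof. by vm_compute. Qed.

Lemma mem_choices (T : eqType) (s : seq (seq T)) (t : seq T) :
  all2 (fun l x => x \in l) s t -> t \in choices s.
Proof.
elim: s t => [|l s IHs] [|x t] //= /andP[xl /IHs ts].
by apply/allpairsP; exists (x, t).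
Qed.

(** * Paths given by their ends and inner vertices *)

Section Links.
Variables (V : finType) (e : rel V).

(** A walk whose inner vertices are [p] in order. Distinctness is kept apart, in one [uniq] for a
    whole configuration. *)
Definition link (x : V) (p : seq V) (y : V) : bool := path e x (rcons p y).

Lemma link_nil x y : link x [::] y = e x y.
Proof. by rewrite /link /= andbT. Qed.

Lemma link_cons x z p y : link x (z :: p) y = e x z && link z p y.
Proof. by []. Qed.

Lemma link_cat x p z q y : link x (p ++ z :: q) y = link x p z && link z q y.
Proof.
by rewrite /link -cat_rcons rcons_cat cat_path last_rcons.
Qed.

Hypothesis e_sym : symmetric e.

Lemma link_rev x p y : link y (rev p) x = link x p y.
Proof.
elim: p x y => [|z p IHp] x y; first by rewrite /= !link_nil e_sym.
by rewrite rev_cons -cats1 link_cat IHp link_cons link_nil e_sym andbC.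
Qed.

End Links.

(** * From colorings of a graph to certificates *)

Section Soundness.
Variables (V : finType) (e : rel V).
Notation palette := ('I_7).

Definition color_set (l : seq nat) : {set palette} := [set c : palette | val c \in l].

Lemma card_color_set l : is_list l -> #|color_set l| = 4.
Proof.
case/and3P=> ul /eqP sz /allP l7.
rewrite -[RHS]sz cardE -(size_map val); apply/perm_size/uniq_perm => //.
  by rewrite map_inj_uniq ?enum_uniq //; apply: val_inj.
move=> c; apply/mapP/idP => [[d + ->]|cl]; first by rewrite mem_enum inE.
by exists (Ordinal (l7 c cl)); rewrite ?mem_enum ?inE.
Qed.

Definition pair_of (S : {set palette}) : nat * nat :=
  let s := [seq val c | c <- enum S] in (nth 0 s 0, nth 0 s 1).

(** The enumeration of a set is a subsequence of that of ['I_7], so [pair_of] lists a two-element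
    set in increasing order, as [color_pairs] does. *)
Lemma enum_ord_sorted (S : {set palette}) : sorted ltn [seq val c | c <- enum S].
Proof.
apply: (subseq_sorted ltn_trans _ (iota_ltn_sorted 0 7)).
rewrite -[iota 0 7]val_enum_ord map_subseq //.
by rewrite {1}/enum_mem -enumT filter_subseq.
Qed.

Lemma pair_ofP (S : {set palette}) : #|S| = 2 ->
  exists a b : palette, [/\ enum S = [:: a; b], a < b & pair_of S = (val a, val b)].
Proof.
rewrite cardE /pair_of; have := enum_ord_sorted S.
case: (enum S) => [|a [|b []]] //= /andP[ab _] _.
by exists a, b.
Qed.

Lemma pair_of_color_pairs (S : {set palette}) l :
  #|S| = 2 -> S \subset color_set l -> pair_of S \in color_pairs l.
Proof.
case/pair_ofP=> a [b [eS ab ->]] /subsetP Sl.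
have Sab c : c \in [:: a; b] -> val c \in l.
  by rewrite -eS mem_enum => /Sl; rewrite inE.
rewrite mem_filter ab; apply/allpairsP; exists (val a, val b).
by rewrite !Sab ?inE ?eqxx ?orbT.
Qed.

Lemma pair_of_disjoint (S T : {set palette}) :
  #|S| = 2 -> #|T| = 2 -> [disjoint S & T] -> pair_disjoint (pair_of S) (pair_of T).
Proof.
case/pair_ofP=> a [b [eS _ ->]] /pair_ofP[a' [b' [eT _ ->]]] dST.
have ne c d : c \in [:: a; b] -> d \in [:: a'; b'] -> val c != val d.
  rewrite -eS -eT !mem_enum => cS dT; apply/eqP => /val_inj cd.
  by move/disjointFr: dST => /(_ c cS); rewrite cd dT.
by apply/and4P; rewrite /= !ne ?inE ?eqxx ?orbT.
Qed.

(** Inside a 4-set, the complement of [Y] is the only 2-set disjoint from [Y]. This makes a pair of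
    padding vertices transparent. *)
Lemma complement_twice (C : finType) (L X Y Z : {set C}) :
  #|L| = 4 -> #|X| = 2 -> #|Y| = 2 -> #|Z| = 2 ->
  X \subset L -> Y \subset L -> Z \subset L ->
  [disjoint X & Y] -> [disjoint Y & Z] -> Z = X.
Proof.
move=> L4 X2 Y2 Z2 XL YL ZL dXY dYZ.
have LY : #|L :\: Y| = 2.
  by have := cardsID Y L; rewrite (setIidPr YL) L4 Y2; lia.
have eqLY (W : {set C}) : #|W| = 2 -> W \subset L -> [disjoint W & Y] -> W = L :\: Y.
  by move=> W2 WL dW; apply/eqP; rewrite eqEcard subsetD WL dW LY W2 /=.
by rewrite (eqLY X X2 XL dXY) (eqLY Z Z2 ZL) // disjoint_sym.
Qed.

Variables (lam : V -> seq nat) (phi : V -> {set palette}).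
Hypothesis lam_list : forall v, is_list (lam v).
Hypothesis phi_sub : forall v, phi v \subset color_set (lam v).
Hypothesis phi_card : forall v, #|phi v| = 2.
Hypothesis phi_disj : forall x y, e x y -> [disjoint phi x & phi y].

Lemma extends_link x p y :
  link e x p y -> extends (pair_of (phi x)) (map lam p) (pair_of (phi y)).
Proof.
elim: p x => [|z p IHp] x /=.
  by rewrite link_nil => /phi_disj; apply: pair_of_disjoint.
rewrite link_cons => /andP[xz zy]; apply/hasP; exists (pair_of (phi z)).
  exact: pair_of_color_pairs.
by rewrite IHp // pair_of_disjoint // phi_disj.
Qed.

(** The first two padding vertices have the list of [x], so by [complement_twice] the second repeats
    the colors of [x] and can take its place. The induction removes padding vertices two at a
    time. *)
Lemma extends_link_padded x p y m ls :
  link e x p y -> ~~ odd m -> map lam p = nseq m (lam x) ++ ls ->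
  extends (pair_of (phi x)) ls (pair_of (phi y)).
Proof.
have [n] := ubnP m; elim: n m x p => // n IHn [|[|m]] x p //= mn xy m2 lp.
  by rewrite -lp extends_link.
case: p xy lp => [|a [|b p]] //; rewrite !link_cons /=.
case/and3P=> xa ab by_ [la lb lp].
have <-: phi b = phi x.
  apply: (@complement_twice _ (color_set (lam x)) (phi x) (phi a) (phi b));
    rewrite ?phi_card ?card_color_set ?phi_disj //.
  - by rewrite -la phi_sub.
  - by rewrite -lb phi_sub.
apply: (IHn m b p); rewrite ?lb //; first lia.
by move: m2; rewrite negbK.
Qed.

End Soundness.

(* Edge [(i, j, ls)] of the certificate may be realised by any path with at
   least as many inner vertices as [ls] and the same parity: the surplus inner
   vertices receive the list of [i], which forces every second one of them to
   repeat the colors of [i]. *)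
Theorem certificate_sound (V : finType) (e : rel V) (ct : certificate)
    (v0 : V) (bs : seq V) (ps : seq (seq V)) :
  uncolorable ct -> size bs = size ct.1 -> uniq (bs ++ flatten ps) ->
  all2 (fun c p => let: (i, j, ls) := c in
     [&& link e (nth v0 bs i) p (nth v0 bs j), size ls <= size p
       & odd (size p) == odd (size ls)]) ct.2 ps ->
  ~ choosable 4 2 e.
Proof.
case: ct => bl ce /= /and3P[/= lists4 indices nocol] szbs ubp cps chos.
(* Any valid list would do: it is given to the vertices outside the subdivision, whose colors do not
   matter. *)
pose default := [:: 0; 1; 2; 3].
pose pad (c : nat * nat * seq (seq nat)) (p : seq V) :=
  nseq (size p - size c.2) (nth default bl c.1.1) ++ c.2.
pose padded := [seq pad t.1 t.2 | t <- zip ce ps].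
have szcp : size ce = size ps by move: cps; rewrite all2E => /andP[/eqP].
have cpsP k : k < size ce -> let c := nth (0, 0, [::]) ce k in
    let p := nth [::] ps k in
    [/\ link e (nth v0 bs c.1.1) p (nth v0 bs c.1.2), size c.2 <= size p
      & odd (size p) == odd (size c.2)].
  move=> kc; move: cps; rewrite all2E szcp eqxx => /(all_nthP ((0, 0, [::]), [::])).
  rewrite size_zip -szcp minnn => /(_ k kc); rewrite nth_zip //=.
  by case: (nth (0, 0, [::]) ce k) => [[i j] ls] /and3P[].
have pad_shape : shape padded = shape ps.
  apply: (@eq_from_nth _ 0); rewrite /shape !size_map size_zip szcp minnn // => k kps.
  rewrite !(nth_map [::]) ?size_map ?size_zip ?szcp ?minnn //.
  rewrite (nth_map ((0, 0, [::]), [::])) ?size_zip ?szcp ?minnn // nth_zip //=.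
  by case: (cpsP k); rewrite ?szcp // => _ ? _; rewrite size_cat size_nseq subnK.
(* Lists are read off by position in [bs ++ flatten ps]. A vertex outside has an index past the end
   and gets [default]. *)
pose lam v := nth default (bl ++ flatten padded) (index v (bs ++ flatten ps)).
have lam_all : map lam (bs ++ flatten ps) = bl ++ flatten padded.
  apply: (@eq_from_nth _ default).
    by rewrite size_map !size_cat szbs !size_flatten pad_shape.
  by rewrite size_map => k kbp; rewrite (nth_map v0) // /lam index_uniq.
have /andP[/eqP lam_bs /eqP lam_ps] :
    (map lam bs == bl) && (map lam (flatten ps) == flatten padded).
  by rewrite -eqseq_cat ?size_map // -map_cat lam_all.
have lam_p k : k < size ce ->
    map lam (nth [::] ps k) = pad (nth (0, 0, [::]) ce k) (nth [::] ps k).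
  move=> kc; have -> : pad (nth (0, 0, [::]) ce k) (nth [::] ps k) = nth [::] padded k.
    by rewrite (nth_map ((0, 0, [::]), [::])) ?nth_zip ?size_zip -?szcp ?minnn.
  have <-: map (map lam) ps = padded.
    apply: eq_from_flatten_shape; first by rewrite -map_flatten.
    by rewrite pad_shape /shape -map_comp; apply: eq_map => p /=; rewrite size_map.
  by rewrite (nth_map [::]) -?szcp.
have lam_list v : is_list (lam v).
  rewrite /lam; set i := index _ _; have [ib|?] := ltnP i (size (bl ++ flatten padded)); last first.
    by rewrite nth_default.
  have: nth default (bl ++ flatten padded) i \in bl ++ flatten padded by apply: mem_nth.
  rewrite mem_cat => /orP[/(allP lists4) //|/flattenP[l lp]].
  case/mapP: lp => -[c p] /= /(nthP ((0, 0, [::]), [::]))[k].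
  rewrite size_zip szcp minnn => kp; rewrite nth_zip // => -[<- <-] ->.
  have/(allP indices)/andP[/andP[i1 i2] /allP cl] :
    nth (0, 0, [::]) ce k \in ce by rewrite mem_nth ?szcp.
  rewrite mem_cat => /orP[/nseqP[-> _]|/cl //].
  by apply: (allP lists4); rewrite mem_nth.
have lam_nth i : i < size bl -> lam (nth v0 bs i) = nth default bl i.
  by move=> ib; rewrite -[in RHS]lam_bs (nth_map v0) ?szbs.
have [phi [phi_sub phi_disj]] := chos _ (fun v => color_set (lam v)) (fun v => card_color_set (lam_list v)).
have phi_card v : #|phi v| = 2 by case: (phi_sub v).
have {}phi_sub v : phi v \subset color_set (lam v) by case: (phi_sub v).
(* The pairs that [phi] gives to the branch vertices are among the enumerated ones, and every edge
   of the certificate extends them, against [nocol]. *)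
move/allP: nocol => /(_ (map (pair_of \o phi) bs)); case/(_ _)/negP.
  apply: mem_choices; rewrite -lam_bs -map_comp.
  elim: (bs) => //= b bs' ->; rewrite andbT.
  exact: pair_of_color_pairs.
apply/(all_nthP (0, 0, [::])) => k kc.
have := cpsP k kc; have := lam_p k kc.
have/(allP indices) := mem_nth (0, 0, [::]) kc.
case: (nth (0, 0, [::]) ce k) => -[i j] ls /= /andP[/andP[ib jb] _].
rewrite /pad /= => lp [lk szl oddl].
rewrite !(nth_map v0) ?szbs //=.
apply: (extends_link_padded lam_list phi_sub phi_card phi_disj lk (m := size (nth [::] ps k) - size ls)).
  by rewrite oddB // (eqP oddl) addbb.
by rewrite lp lam_nth.
Qed.

(** * Distinctness by counting, and the bipartition *)

(** Turns the distinctness of rearranged, reversed or partial vertex lists into linear arithmetic on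
    multiplicities; [uniq_from] automates this. *)
Lemma uniq_sub_count (T : eqType) (s t : seq T) :
  uniq t -> (forall z, count_mem z s <= count_mem z t) -> uniq s.
Proof.
move=> ut st; apply: count_mem_uniq => z; rewrite -has_pred1 has_count.
have := st z; rewrite (count_uniq_mem z ut); lia.
Qed.

Ltac count_lia := clear;
  repeat match goal with
  | |- context [nat_of_bool ?b] => generalize (nat_of_bool b); intro
  | |- context [count ?a ?s] => generalize (count a s); intro
  end; lia.

Ltac uniq_from H :=
  apply: (uniq_sub_count H) => ?; rewrite /= ?(count_cat, count_rev) /=
    ?(count_cat, count_rev) /= ?(count_cat, count_rev) /=; count_lia.

Ltac size_lia :=
  repeat match goal with
  | H : ?P |- _ =>
      lazymatch P with context [size _] => fail | _ => clear H end
  end; lia.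

(* With all lists equal to the same four colors, adjacent vertices receive
   complementary pairs, so whether a fixed color is used is a 2-coloring. *)
Lemma choosable_bipartite (V : finType) (e : rel V) : choosable 4 2 e ->
  exists c : V -> bool, forall x y, e x y -> c y = ~~ c x.
Proof.
case/(_ 'I_4 (fun _ => setT)) => [v|phi [phiP dphi]]; first by rewrite cardsT card_ord.
exists (fun v => ord0 \in phi v) => x y /dphi dxy.
have -> : phi y = ~: phi x; last by rewrite inE.
apply/eqP; rewrite eqEcard subsetC -disjoints_subset dxy /=.
by rewrite cardsCs setCK card_ord; have [_ ->] := phiP x; have [_ ->] := phiP y.
Qed.

(** * Theta subgraphs and pairs of cycles *)

Section Configurations.
Variables (V : finType) (e : rel V).
Hypothesis e_sym : symmetric e.
Hypothesis e_chos : choosable 4 2 e.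
Variable c : V -> bool.
Hypothesis e_c : forall x y, e x y -> c y = ~~ c x.
Notation link := (link e).
Let link_rev := @link_rev V e e_sym.

(** The number of inner vertices is one less than the length, so it is odd exactly when the length
    is even. All parities below are those of inner vertices. *)
Lemma link_odd x p y : link x p y -> odd (size p) = (c x == c y).
Proof.
elim: p x => [|z p IHp] x; first by rewrite link_nil => /e_c ->; case: (c x).
by rewrite link_cons => /andP[/e_c cz /IHp /= ->]; rewrite cz; case: (c x); case: (c y).
Qed.

Lemma no_certificate (ct : certificate) (v0 : V) (bs : seq V) (ps : seq (seq V)) :
  uncolorable ct -> uniq (bs ++ flatten ps) -> size bs = size ct.1 ->
  all2 (fun d p => let: (i, j, ls) := d in
     [&& link (nth v0 bs i) p (nth v0 bs j), size ls <= size p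
       & odd (size p) == odd (size ls)]) ct.2 ps -> False.
Proof. by move=> un ups szbs cps; apply: (certificate_sound un szbs ups cps). Qed.

(** An empty list is the edge between [u] and [v]. Two empty lists are not excluded here; where this
    matters, a count of nonempty paths is assumed. *)
Definition theta u v p q r : bool :=
  [&& link u p v, link u q v, link u r v & uniq (u :: v :: p ++ q ++ r)].

Lemma thetaP u v p q r : theta u v p q r ->
  [/\ link u p v, link u q v, link u r v & uniq (u :: v :: p ++ q ++ r)].
Proof. by case/and4P. Qed.

Lemma theta_swap12 u v p q r : theta u v p q r -> theta u v q p r.
Proof. by case/thetaP=> lp lq lr U; rewrite /theta lp lq lr; uniq_from U. Qed.

Lemma theta_swap23 u v p q r : theta u v p q r -> theta u v p r q.
Proof. by case/thetaP=> lp lq lr U; rewrite /theta lp lq lr; uniq_from U. Qed.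

(** The three paths have equal parity. If each has at least two inner vertices, then the even case
    contains a padded [theta333]; in the odd case each has at least three, which gives
    [theta444]. *)
Lemma theta_short u v p q r : theta u v p q r ->
  [|| size p <= 1, size q <= 1 | size r <= 1].
Proof.
case/thetaP=> lp lq lr U; apply/negPn/negP; rewrite !negb_or -!ltnNge => /and3P[p2 q2 r2].
have := link_odd lp; have := link_odd lq; have := link_odd lr.
have Ups : uniq ([:: u; v] ++ flatten [:: p; q; r]) by uniq_from U.
case: (c u == c v) => or oq op.
  apply: (no_certificate (v0 := u) theta444P Ups) => //=.
  rewrite lp lq lr; size_lia.
apply: (no_certificate (v0 := u) theta333P Ups) => //=.
rewrite lp lq lr; size_lia.
Qed.
Ltac certify H := apply: H => //=; repeat (apply/andP; split); first [assumption | size_lia].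

(** Two cycles share [a], and [t] joins them. With the shorter path of each cycle named first,
    [theta_short] at [a], [b] and at [a], [d] bounds [p] and [r] by one inner vertex; the parities
    then select a certificate. The last two hypotheses say that neither cycle is a doubled edge. *)
Lemma no_fat a b d p q r s t :
  link a p b -> link a q b -> link a r d -> link a s d -> link b t d ->
  uniq (a :: b :: d :: p ++ q ++ r ++ s ++ t) ->
  0 < size p + size q -> 0 < size r + size s -> False.
Proof.
wlog pq : p q / size p <= size q => [th|].
  have [pq|/ltnW qp] := leqP (size p) (size q); first exact: (th p q).
  by move=> lp lq lr ls lt U ??; apply: (th q p) => //; [uniq_from U | size_lia].
wlog rs : r s / size r <= size s => [th|].
  have [rs|/ltnW sr] := leqP (size r) (size s); first exact: (th r s).
  by move=> lp lq lr ls lt U ??; apply: (th s r) => //; [uniq_from U | size_lia].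
wlog pr : b d p q r s t pq rs / size p <= size r => [th|].
  have [pr|/ltnW rp] := leqP (size p) (size r); first exact: (th b d p q r s t).
  move=> lp lq lr ls lt U ??; apply: (th d b r s p q (rev t)) => //.
    by rewrite link_rev.
  by uniq_from U.
move=> lp lq lr ls lt U pq0 rs0.
have /theta_short : theta a b p q (s ++ d :: rev t).
  by rewrite /theta lp lq link_cat ls link_rev // lt; uniq_from U.
have /theta_short : theta a d r s (q ++ b :: t).
  by rewrite /theta lr ls link_cat lq lt; uniq_from U.
rewrite !size_cat /= size_rev => r1' p1'.
have p1 : size p <= 1 by clear r1'; size_lia.
have r1 : size r <= 1 by clear p1'; size_lia.
clear p1' r1'; have := link_odd lp; have := link_odd lq; have := link_odd lr; have := link_odd ls.
have := link_odd lt.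
have Ups : uniq ([:: a; b; d] ++ flatten [:: p; q; r; s; t]) by uniq_from U.
case cb : (c a == c b); case cd : (c a == c d) => ot os or oq op.
- have {}ot : odd (size t) by rewrite ot -(eqP cb).
  by certify (no_certificate (v0 := a) fat22222P Ups).
(* Here [p] is odd and [r] is empty, against the ordering [size p <= size r]. *)
- by size_lia.
- have {}ot : ~~ odd (size t) by rewrite ot -(eqP cd) eq_sym cb.
  by certify (no_certificate (v0 := a) fat13221P Ups).
have {}ot : odd (size t) by rewrite ot; move: cb cd; case: (c a); case: (c b); case: (c d).
by certify (no_certificate (v0 := a) fat13132P Ups).
Qed.

(** The analogue of [no_fat] for two disjoint cycles joined by the disjoint paths [r] and [s]. The
    parities of [p], [r] and [t] determine the others; six of the eight cases have a certificate,
    and two contradict [size p <= size t]. *)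
Lemma no_dbl a b d f p q r s t w :
  link a p b -> link a q b -> link d t f -> link d w f -> link a r d -> link b s f ->
  uniq (a :: b :: d :: f :: p ++ q ++ r ++ s ++ t ++ w) ->
  0 < size p + size q -> 0 < size t + size w -> False.
Proof.
wlog pq : p q / size p <= size q => [th|].
  have [pq|/ltnW qp] := leqP (size p) (size q); first exact: (th p q).
  by move=> ?????? U ??; apply: (th q p) => //; [uniq_from U | size_lia].
wlog tw : t w / size t <= size w => [th|].
  have [tw|/ltnW wt] := leqP (size t) (size w); first exact: (th t w).
  by move=> ?????? U ??; apply: (th w t) => //; [uniq_from U | size_lia].
wlog pt : a b d f p q r s t w pq tw / size p <= size t => [th|].
  have [pt|/ltnW tp] := leqP (size p) (size t); first exact: (th a b d f p q r s t w).
  move=> ?????? U ??; apply: (th d f a b t w (rev r) (rev s) p q) => //.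
  - by rewrite link_rev.
  - by rewrite link_rev.
  by uniq_from U.
move=> lp lq lt lw lr ls U pq0 tw0.
have /theta_short : theta a b p q (r ++ d :: w ++ f :: rev s).
  by rewrite /theta lp lq !link_cat lr lw link_rev // ls; uniq_from U.
have /theta_short : theta d f t w (rev r ++ a :: q ++ b :: s).
  by rewrite /theta lt lw !link_cat lq ls link_rev // lr; uniq_from U.
rewrite !(size_cat, size_rev) /= !(size_cat, size_rev) /= size_rev => t1 p1.
have {}p1 : size p <= 1 by size_lia.
have {}t1 : size t <= 1 by size_lia.
have oq : odd (size q) = odd (size p) by rewrite (link_odd lp) (link_odd lq).
have ow : odd (size w) = odd (size t) by rewrite (link_odd lt) (link_odd lw).
have os : odd (size s) = odd (size p) (+) odd (size r) (+) odd (size t).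
  rewrite (link_odd lp) (link_odd lr) (link_odd lt) (link_odd ls).
  by case: (c a); case: (c b); case: (c d); case: (c f).
have Ups : uniq ([:: a; b; d; f] ++ flatten [:: p; q; r; s; t; w]) by uniq_from U.
case op : (odd (size p)); case ot : (odd (size t)); case or : (odd (size r));
  move: oq ow os; rewrite op ot or /= => oq ow os.
- by certify (no_certificate (v0 := a) dbl222222P Ups).
- by certify (no_certificate (v0 := a) dbl221122P Ups).
- by size_lia.
- by size_lia.
- by certify (no_certificate (v0 := a) dbl132122P Ups).
- by certify (no_certificate (v0 := a) dbl131222P Ups).
- by certify (no_certificate (v0 := a) dbl132213P Ups).
- by certify (no_certificate (v0 := a) dbl131113P Ups).
Qed.

(** * Edges of a path, and ears on one path of a theta *)

Definition ends x y : rel V :=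
  fun a b => (a == x) && (b == y) || (a == y) && (b == x).

(** The edges of the path as unordered pairs. They tell a genuine ear without inner vertices, that
    is a chord, from an edge already present. *)
Fixpoint uses (x : V) (p : seq V) (y : V) : rel V :=
  if p is z :: q then fun a b => ends x z a b || uses z q y a b else ends x y.

Lemma uses_cat x p z q y a b :
  uses x (p ++ z :: q) y a b = uses x p z a b || uses z q y a b.
Proof. by elim: p x => //= w p IHp x; rewrite IHp orbA. Qed.

Lemma ends_sym x y a b : ends x y a b = ends y x a b.
Proof. by rewrite /ends orbC. Qed.

Lemma ends_comm x y a b : ends x y a b = ends x y b a.
Proof. by rewrite /ends orbC andbC (andbC (a == x)). Qed.

Lemma uses_rev x p y a b : uses y (rev p) x a b = uses x p y a b.
Proof.
elim: p x => [|z p IHp] x /=; first exact: ends_sym.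
by rewrite rev_cons -cats1 uses_cat IHp /= orbC (ends_sym z).
Qed.

Lemma uses_comm x p y a b : uses x p y a b = uses x p y b a.
Proof. by elim: p x => [|z p IHp] x /=; rewrite ends_comm // IHp. Qed.

Lemma uses_link x p y a b : link x p y -> uses x p y a b -> e a b.
Proof.
have ends_e z w : e z w -> ends z w a b -> e a b.
  by move=> zw /orP[] /andP[/eqP-> /eqP->] //; rewrite e_sym.
elim: p x => [|z p IHp] x /=; first by rewrite link_nil; apply: ends_e.
by rewrite link_cons => /andP[xz zy] /orP[/(ends_e _ _ xz)|/(IHp _ zy)].
Qed.

(** The ear closes a cycle with the segment of [p] between its ends, and [q] with [r] forms another
    cycle. If [b] is an end of [p] the cycles share [b], as in [no_fat]; otherwise they are disjoint
    and the rest of [p] joins them, as in [no_dbl]. By the last hypothesis the first cycle is not a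
    doubled edge. *)
Lemma no_ear_same_path u v p q r a b R :
  theta u v p q r -> 0 < size q + size r -> link a R b ->
  uniq (u :: v :: p ++ q ++ r ++ R) -> a \in p -> b \in u :: v :: p -> a != b ->
  (R = [::] -> ~~ uses u p v a b) -> False.
Proof.
case/thetaP=> lp lq lr _ qr0 lR U ap.
case/splitPr: ap lp U => p1 p2; rewrite link_cat => /andP[lp1 lp2] U bp ab nuse.
have [bu|nbu] := eqVneq b u.
  subst b; apply: (@no_fat u a v p1 (rev R) q r p2) => //.
  - by rewrite link_rev.
  - by uniq_from U.
  case: R nuse {lR U} => [/(_ erefl)|z R _]; last by rewrite size_rev addnS.
  by case: p1 lp1 {bp} => //= _; rewrite /ends !eqxx orbT.
have [bv|nbv] := eqVneq b v.
  subst b; apply: (@no_fat v a u (rev p2) (rev R) (rev q) (rev r) (rev p1)); rewrite ?link_rev //.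
  - by uniq_from U.
  - rewrite !size_rev; case: R nuse {lR U} => [/(_ erefl)|z R _]; last by rewrite addnS.
    by case: p2 lp2 {bp} => //= _; rewrite uses_cat /= /ends !eqxx orbT.
  by rewrite !size_rev.
move: bp; rewrite !inE (negPf nbu) (negPf nbv) mem_cat inE eq_sym (negPf ab) /=.
case/orP=> [bp1|bp2].
  case/splitPr: bp1 lp1 U nuse => s t; rewrite link_cat => /andP[ls lt] U nuse.
  apply: (@no_dbl b a u v t (rev R) (rev s) p2 q r); rewrite ?link_rev //.
    by uniq_from U.
  case: R nuse {lR U} => [/(_ erefl)|z R _]; last by rewrite size_rev addnS.
  by case: t lt => //= _; rewrite !uses_cat /= /ends !eqxx !orbT.
case/splitPr: bp2 lp2 U nuse => s t; rewrite link_cat => /andP[ls lt] U nuse.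
apply: (@no_dbl a b u v s R (rev p1) t q r); rewrite ?link_rev //.
  by uniq_from U.
case: R nuse {lR U} => [/(_ erefl)|z R _]; last by rewrite addnS.
by case: s ls => //= _; rewrite !uses_cat /= /ends !eqxx !orbT.
Qed.

(** * Four parallel paths, and subdivisions of [K_4] *)

(** If the parities are even, [theta_short] puts an empty path among every three, so two of the four
    are empty, against the count. If they are odd, a path that is not a single vertex has at least
    three and gives [theta2224]. *)
Lemma theta4_sizes u v p q r s :
  link u p v -> link u q v -> link u r v -> link u s v ->
  uniq (u :: v :: p ++ q ++ r ++ s) ->
  2 < (0 < size p) + (0 < size q) + (0 < size r) + (0 < size s) ->
  [/\ size p = 1, size q = 1, size r = 1 & size s = 1].
Proof.
move=> lp lq lr ls U nonempty.
have /theta_short h1 : theta u v p q r by rewrite /theta lp lq lr; uniq_from U.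
have /theta_short h2 : theta u v p q s by rewrite /theta lp lq ls; uniq_from U.
have /theta_short h3 : theta u v p r s by rewrite /theta lp lr ls; uniq_from U.
have /theta_short h4 : theta u v q r s by rewrite /theta lq lr ls; uniq_from U.
have op := link_odd lp; have oq := link_odd lq; have or := link_odd lr.
have os := link_odd ls.
case cuv : (c u == c v) op oq or os => op oq or os; last first.
  have even_short w : odd (size w) = false -> (size w <= 1) = ~~ (0 < size w).
    by case: w => [|? []].
  move: h1 h2 h3 h4 nonempty; rewrite !even_short //.
  by do 4![case: (0 < size _)].
have no_long w1 w2 w3 w4 : link u w1 v -> link u w2 v -> link u w3 v -> link u w4 v ->
    uniq (u :: v :: w1 ++ w2 ++ w3 ++ w4) -> size w4 <= 1.
  move=> l1 l2 l3 l4 U'; rewrite leqNgt; apply/negP => w4_long.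
  have o1 := link_odd l1; have o2 := link_odd l2; have o3 := link_odd l3.
  have o4 := link_odd l4; rewrite cuv in o1 o2 o3 o4.
  have Uw : uniq ([:: u; v] ++ flatten [:: w1; w2; w3; w4]) by uniq_from U'.
  by clear h1 h2 h3 h4; certify (no_certificate (v0 := u) theta2224P Uw).
have p1 : size p <= 1 by apply: (no_long q r s p) => //; uniq_from U.
have q1 : size q <= 1 by apply: (no_long p r s q) => //; uniq_from U.
have r1 : size r <= 1 by apply: (no_long p q s r) => //; uniq_from U.
have s1 : size s <= 1 by apply: (no_long p q r s) => //; uniq_from U.
have size1 w : odd (size w) -> size w <= 1 -> size w = 1 by case: w => [|? []].
by split; apply: size1.
Qed.

(* The endpoints [a], [b] of the first path are on the same side, so [d] and
   [f] must both lie on the other side. *)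
Lemma K4_sizes a b d f ab ad af bd bf df :
  link a ab b -> link a ad d -> link a af f -> link b bd d -> link b bf f ->
  link d df f -> uniq (a :: b :: d :: f :: ab ++ ad ++ af ++ bd ++ bf ++ df) ->
  odd (size ab) ->
  [/\ odd (size df), [&& size ad == 0, size af == 0, size bd == 0 & size bf == 0]
    & (size ab == 1) || (size df == 1)].
Proof.
move=> lab lad laf lbd lbf ldf U oab.
have oad := link_odd lad; have oaf := link_odd laf; have obd := link_odd lbd.
have obf := link_odd lbf; have odf := link_odd ldf.
have cab : c b = c a by apply/esym/eqP; rewrite -(link_odd lab).
have Ups : uniq ([:: a; b; d; f] ++ flatten [:: ab; ad; af; bd; bf; df]) by uniq_from U.
have Ups1 : uniq ([:: d; a; b; f] ++ flatten [:: rev ad; rev bd; df; ab; af; bf]) by uniq_from U.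
have Ups2 : uniq ([:: f; a; b; d] ++ flatten [:: rev af; rev bf; rev df; ab; ad; bd]) by uniq_from U.
have Ups3 : uniq ([:: a; b; d; f] ++ flatten [:: ad; af; bd; bf; ab; df]) by uniq_from U.
have lad' := lad; have laf' := laf; have lbd' := lbd; have lbf' := lbf.
have ldf' := ldf; rewrite -link_rev in lad'; rewrite -link_rev in laf'.
rewrite -link_rev in lbd'; rewrite -link_rev in lbf'; rewrite -link_rev in ldf'.
have [cda|cda] := boolP (c a == c d).
  have {}oad : odd (size ad) by rewrite oad.
  have {}obd : odd (size bd) by rewrite obd cab.
  have [cfa|cfa] := boolP (c a == c f).
    have {}oaf : odd (size af) by rewrite oaf.
    have {}obf : odd (size bf) by rewrite obf cab.
    have {}odf : odd (size df) by rewrite odf -(eqP cda).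
    by case: (no_certificate (v0 := a) K4_222222P Ups _) => //=;
      repeat (apply/andP; split); first [assumption | size_lia].
  have {}oaf : ~~ odd (size af) by rewrite oaf.
  have {}obf : ~~ odd (size bf) by rewrite obf cab.
  have {}odf : ~~ odd (size df) by rewrite odf -(eqP cda).
  by case: (no_certificate (v0 := a) K4_111222P Ups2 _) => //=; rewrite ?size_rev;
    repeat (apply/andP; split); first [assumption | size_lia].
have {}oad : ~~ odd (size ad) by rewrite oad.
have {}obd : ~~ odd (size bd) by rewrite obd cab.
have [cfa|cfa] := boolP (c a == c f).
  have {}oaf : odd (size af) by rewrite oaf.
  have {}obf : odd (size bf) by rewrite obf cab.
  have {}odf : ~~ odd (size df) by rewrite odf eq_sym -(eqP cfa).
  by case: (no_certificate (v0 := a) K4_111222P Ups1 _) => //=; rewrite ?size_rev;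
    repeat (apply/andP; split); first [assumption | size_lia].
have {}oaf : ~~ odd (size af) by rewrite oaf.
have {}obf : ~~ odd (size bf) by rewrite obf cab.
have {}odf : odd (size df).
  by rewrite odf; move: cda cfa; case: (c a); case: (c d); case: (c f).
have short : (size ab == 1) || (size df == 1).
  apply/negPn/negP; rewrite negb_or => /andP[ab_long df_long]; apply: (no_certificate (v0 := a) K4_111144P Ups3) => //=.
  by repeat (apply/andP; split); first [assumption | size_lia].
(* Each of the four paths between [a], [b] and [d], [f] lies in a theta whose other two paths
   contain [ab] or [df] and one further vertex. As [ab] and [df] are odd, these have at least two
   inner vertices, so the even path is empty. *)
have /theta_short tad : theta a d ad (ab ++ b :: bd) (af ++ f :: rev df).
  by rewrite /theta !link_cat lad lab lbd laf ldf'; uniq_from U.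
have /theta_short taf : theta a f af (ab ++ b :: bf) (ad ++ d :: df).
  by rewrite /theta !link_cat laf lab lbf lad ldf; uniq_from U.
have /theta_short tbd : theta b d bd (rev ab ++ a :: ad) (bf ++ f :: rev df).
  by rewrite /theta !link_cat link_rev lbd lab lad lbf ldf'; uniq_from U.
have /theta_short tbf : theta b f bf (rev ab ++ a :: af) (bd ++ d :: df).
  by rewrite /theta !link_cat link_rev lbf lab laf lbd ldf; uniq_from U.
move: tad taf tbd tbf; rewrite !(size_cat, size_rev) /= !size_rev => tad taf tbd tbf.
clear Ups Ups1 Ups2 Ups3.
have ad0 : size ad == 0 by clear taf tbd tbf short; size_lia.
have af0 : size af == 0 by clear tad tbd tbf short; size_lia.
have bd0 : size bd == 0 by clear taf tad tbf short; size_lia.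
have bf0 : size bf == 0 by clear taf tbd tad short; size_lia.
by rewrite ad0 af0 bd0 bf0.
Qed.

(* [K33_minus_edge] with one edge at a vertex of degree 2 subdivided: a 4-cycle
   [x1 y1 x2 y2], a path [y1 z y2] and a path from [x1] to [x2] through [A]. *)
Definition long_K33e x1 x2 y1 y2 z (A : seq V) : bool :=
  [&& e x1 y1, e x1 y2, e x2 y1 & e x2 y2] &&
  [&& e y1 z, e z y2, link x1 A x2, odd (size A)
    & uniq (x1 :: x2 :: y1 :: y2 :: z :: A)].

(** Two of [a], [b], [d] lie in one class, so after renaming [ab] is odd. By [K4_sizes] the paths
    other than [ab] and [df] form a 4-cycle; the one of [ab] and [df] with a single inner vertex
    supplies [z], the other supplies [A]. *)
Lemma K4_long_K33e a b d f ab ad af bd bf df :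
  link a ab b -> link a ad d -> link a af f -> link b bd d -> link b bf f ->
  link d df f -> uniq (a :: b :: d :: f :: ab ++ ad ++ af ++ bd ++ bf ++ df) ->
  exists x1 x2 y1 y2 z A, long_K33e x1 x2 y1 y2 z A.
Proof.
move=> lab lad laf lbd lbf ldf U.
wlog oab : a b d ab ad af bd bf df lab lad laf lbd lbf ldf U / odd (size ab) => [th|].
  have [oab|/negPf oab] := boolP (odd (size ab)); first exact: (th a b d ab ad af bd bf df).
  have [oad|/negPf oad] := boolP (odd (size ad)).
    by apply: (th a d b ad ab af (rev bd) df bf); rewrite ?link_rev //; uniq_from U.
  have obd : odd (size bd).
    move: oab oad; rewrite (link_odd lab) (link_odd lad) (link_odd lbd).
    by case: (c a); case: (c b); case: (c d).
  by apply: (th b d a bd (rev ab) bf (rev ad) df af); rewrite ?link_rev //; uniq_from U.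
have [odf /and4P[ad0 af0 bd0 bf0] short] := K4_sizes lab lad laf lbd lbf ldf U oab.
move: lad laf lbd lbf U; rewrite (size0nil (eqP ad0)) (size0nil (eqP af0)).
rewrite (size0nil (eqP bd0)) (size0nil (eqP bf0)) !link_nil => lad laf lbd lbf U.
case/orP: short => [ab1|df1].
  case: ab ab1 lab U {oab} => [|z []] // _; rewrite link_cons link_nil => /andP[az zb] U.
  exists d, f, a, b, z, df; rewrite /long_K33e az zb ldf odf e_sym lad e_sym lbd.
  by rewrite e_sym laf e_sym lbf; uniq_from U.
case: df df1 ldf U {odf} => [|z []] // _; rewrite link_cons link_nil => /andP[dz zf] U.
exists a, b, d, f, z, ab; rewrite /long_K33e dz zf lab oab lad laf lbd lbf.
by uniq_from U.
Qed.

(** * Ears on a subdivided [K_{3,3} - e] *)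

Definition uses_long_K33e x1 x2 y1 y2 z A : rel V := fun a b =>
  [|| uses x1 [:: y1] x2 a b, uses x1 [:: y2] x2 a b, uses x1 A x2 a b
    | uses y1 [:: z] y2 a b].

Lemma long_K33e_swap_x x1 x2 y1 y2 z A :
  long_K33e x1 x2 y1 y2 z A -> long_K33e x2 x1 y1 y2 z (rev A).
Proof.
case/andP=> /and4P[a1 a2 a3 a4] /and5P[a5 a6 a7 a8 U].
rewrite /long_K33e a1 a2 a3 a4 a5 a6 link_rev a7 size_rev a8.
by uniq_from U.
Qed.

Lemma long_K33e_swap_y x1 x2 y1 y2 z A :
  long_K33e x1 x2 y1 y2 z A -> long_K33e x1 x2 y2 y1 z A.
Proof.
case/andP=> /and4P[a1 a2 a3 a4] /and5P[a5 a6 a7 a8 U].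
rewrite /long_K33e a1 a2 a3 a4 e_sym a6 e_sym a5 a7 a8.
by uniq_from U.
Qed.

Lemma uses_long_K33e_swap_x x1 x2 y1 y2 z A a b :
  uses_long_K33e x2 x1 y1 y2 z (rev A) a b = uses_long_K33e x1 x2 y1 y2 z A a b.
Proof. by rewrite /uses_long_K33e -!(uses_rev x1). Qed.

Lemma uses_long_K33e_swap_y x1 x2 y1 y2 z A a b :
  uses_long_K33e x1 x2 y2 y1 z A a b = uses_long_K33e x1 x2 y1 y2 z A a b.
Proof. by rewrite /uses_long_K33e -(uses_rev y1) orbCA. Qed.

Ltac use_cases :=
  rewrite -?cats1 ?(uses_cat, uses_rev) /uses_long_K33e /=;
  repeat match goal with
  | |- context [ends ?x ?y ?a ?b] =>
      rewrite ?[ends y x a b]ends_sym; case: (ends x y a b)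
  | |- context [uses ?x ?p ?y ?a ?b] => case: (uses x p y a b)
  end; rewrite ?orbT.

Definition long_K33e_ear x1 x2 y1 y2 z A a R b : Prop :=
  [/\ long_K33e x1 x2 y1 y2 z A, link a R b, a != b,
      uniq (x1 :: x2 :: y1 :: y2 :: z :: A ++ R)
    & R = [::] -> ~~ uses_long_K33e x1 x2 y1 y2 z A a b].

Lemma long_K33e_ear_rev x1 x2 y1 y2 z A a R b :
  long_K33e_ear x1 x2 y1 y2 z A a R b -> long_K33e_ear x1 x2 y1 y2 z A b (rev R) a.
Proof.
case=> D lR ab U nuse; split=> //.
- by rewrite link_rev.
- by rewrite eq_sym.
- by uniq_from U.
move=> R0; have {}R0 : R = [::] by rewrite -(revK R) R0.
apply: contra (nuse R0) => /or4P[]; rewrite uses_comm => u;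
  by rewrite /uses_long_K33e u ?orbT.
Qed.

Lemma long_K33e_ear_swap_x x1 x2 y1 y2 z A a R b :
  long_K33e_ear x1 x2 y1 y2 z A a R b -> long_K33e_ear x2 x1 y1 y2 z (rev A) a R b.
Proof.
case=> D lR ab U nuse; split=> //.
- exact: long_K33e_swap_x.
- by uniq_from U.
by move/nuse; rewrite uses_long_K33e_swap_x.
Qed.

Lemma long_K33e_ear_swap_y x1 x2 y1 y2 z A a R b :
  long_K33e_ear x1 x2 y1 y2 z A a R b -> long_K33e_ear x1 x2 y2 y1 z A a R b.
Proof.
case=> D lR ab U nuse; split=> //.
- exact: long_K33e_swap_y.
- by uniq_from U.
by move/nuse; rewrite uses_long_K33e_swap_y.
Qed.

Section LongK33eEar.
Variables (x1 x2 y1 y2 z : V) (A R : seq V).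
Notation ear a b := (long_K33e_ear x1 x2 y1 y2 z A a R b).

(** For this and the next five lemmas, dropping a suitable edge or path of the configuration leaves
    a theta with both ends of the ear on one of its paths, so [no_ear_same_path] applies. Here the
    edge between [x1] and [y1] is dropped. *)
Lemma no_ear_x1_x2 : ~ ear x1 x2.
Proof.
case=> /andP[/and4P[a1 a2 a3 a4] /and5P[a5 a6 a7 a8 _]] lR ab U nuse.
apply: (@no_ear_same_path x2 y2 (rcons (rev A) x1) [::] [:: y1; z] x1 x2 R) => //.
- rewrite /theta -cats1 link_cat link_rev a7 !link_cons !link_nil a2 a4 a3 a5 a6.
  by uniq_from U.
- by rewrite -cats1; uniq_from U.
- by rewrite mem_rcons inE eqxx.
- by rewrite inE eqxx.
by move/nuse; apply: contra; use_cases.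
Qed.

Lemma no_ear_y1_y2 : ~ ear y1 y2.
Proof.
case=> /andP[/and4P[a1 a2 a3 a4] /and5P[a5 a6 a7 a8 _]] lR ab U nuse.
apply: (@no_ear_same_path x2 y2 [:: y1; z] [::] (rcons (rev A) x1) y1 y2 R) => //.
- rewrite /theta -cats1 link_cat link_rev a7 !link_cons !link_nil a2 a4 a3 a5 a6.
  by uniq_from U.
- by rewrite size_rcons.
- by rewrite -cats1; uniq_from U.
- by rewrite inE eqxx.
- by rewrite !inE eqxx orbT.
by move/nuse; apply: contra; use_cases.
Qed.

Lemma no_ear_z_x1 : ~ ear z x1.
Proof.
case=> /andP[/and4P[a1 a2 a3 a4] /and5P[a5 a6 a7 a8 _]] lR ab U nuse.
apply: (@no_ear_same_path x1 y2 [:: y1; z] [::] (rcons A x2) z x1 R) => //.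
- rewrite /theta -cats1 link_cat a7 !link_cons !link_nil a2 a4 a1 a5 a6.
  by uniq_from U.
- by rewrite size_rcons.
- by rewrite -cats1; uniq_from U.
- by rewrite !inE eqxx orbT.
- by rewrite !inE eqxx.
by move/nuse; apply: contra; use_cases.
Qed.

Lemma no_ear_z_y1 : ~ ear z y1.
Proof.
case=> /andP[/and4P[a1 a2 a3 a4] /and5P[a5 a6 a7 a8 _]] lR ab U nuse.
apply: (@no_ear_same_path y1 y2 [:: z] [:: x1] [:: x2] z y1 R) => //.
- by rewrite /theta !link_cons !link_nil a5 a6 (e_sym y1) a1 a2 (e_sym y1) a3 a4; uniq_from U.
- by uniq_from U.
- by rewrite !inE eqxx.
- by rewrite !inE eqxx.
by move/nuse; apply: contra; use_cases.
Qed.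

Lemma no_ear_A_y1 a : a \in x1 :: A -> ~ ear a y1.
Proof.
move=> aA [/andP[/and4P[a1 a2 a3 a4] /and5P[a5 a6 a7 a8 _]] lR ab U nuse].
apply: (@no_ear_same_path x2 y1 (rcons (rev A) x1) [::] [:: y2; z] a y1 R) => //.
- rewrite /theta -cats1 link_cat link_rev a7 !link_cons !link_nil a1 a3 a4.
  by rewrite (e_sym y2) a6 (e_sym z) a5; uniq_from U.
- by rewrite -cats1; uniq_from U.
- by rewrite mem_rcons inE mem_rev -in_cons.
- by rewrite !inE eqxx orbT.
by move/nuse; apply: contra; use_cases.
Qed.

Lemma no_ear_A_A a b : a \in A -> b \in x1 :: x2 :: A -> ~ ear a b.
Proof.
move=> aA bA [/andP[/and4P[a1 a2 a3 a4] /and5P[a5 a6 a7 a8 _]] lR ab U nuse].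
apply: (@no_ear_same_path x1 x2 A [:: y1] [:: y2] a b R) => //.
- by rewrite /theta !link_cons !link_nil a1 a2 a7 (e_sym y1) a3 (e_sym y2) a4; uniq_from U.
- by uniq_from U.
by move/nuse; apply: contra; use_cases.
Qed.

(** The ear creates subdivisions of [K_4] with branch vertices [x2], [z], [y2], [a] and [x1], [z],
    [y2], [a]. Applied to both, [K4_sizes] makes the ear and both parts of [A] single edges, which
    leaves [K_{3,3}] with sides [x1], [x2], [z] and [y1], [y2], [a]. *)
Lemma no_ear_A_z a : a \in A -> ~ ear a z.
Proof.
move=> aA [/andP[/and4P[a1 a2 a3 a4] /and5P[a5 a6 a7 a8 _]] lR ab U nuse].
case/splitPr: aA a7 {a8 nuse} U => A1 A2; rewrite link_cat => /andP[l1 l2] U.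
have [||||||||_ /and4P[_ nA2 _ nR] _] :=
  @K4_sizes x2 z y2 a [:: y1] [::] (rev A2) [::] (rev R) (x1 :: A1).
- by rewrite link_cons link_nil a3 a5.
- by rewrite link_nil.
- by rewrite link_rev.
- by rewrite link_nil.
- by rewrite link_rev.
- by rewrite link_cons e_sym a2.
- by uniq_from U.
- by [].
have [||||||||_ /and4P[_ nA1 _ _] _] :=
  @K4_sizes x1 z y2 a [:: y1] [::] A1 [::] (rev R) (x2 :: rev A2).
- by rewrite link_cons link_nil a1 a5.
- by rewrite link_nil.
- by [].
- by rewrite link_nil.
- by rewrite link_rev.
- by rewrite link_cons e_sym a4 link_rev.
- by uniq_from U.
- by [].
rewrite size_rev in nA2; rewrite size_rev in nR.
move: l1 l2 lR U; rewrite (size0nil (eqP nA1)) (size0nil (eqP nA2)) (size0nil (eqP nR)).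
rewrite !link_nil => l1 l2 lR U.
have Ups : uniq ([:: x1; x2; z; y1; y2; a] ++ flatten (nseq 9 [::])) by uniq_from U.
apply: (no_certificate (v0 := a) K33_certP Ups) => //=.
by rewrite !link_nil a1 a2 a3 a4 (e_sym z y1) a5 a6 l1 (e_sym x2) l2 (e_sym z) lR.
Qed.

End LongK33eEar.

(** Reversing the ear and swapping [x1] with [x2] or [y1] with [y2] reduces every pair of ends to
    one treated above. *)
Lemma long_K33e_no_ear x1 x2 y1 y2 z A a R b :
  a \in x1 :: x2 :: y1 :: y2 :: z :: A -> b \in x1 :: x2 :: y1 :: y2 :: z :: A ->
  ~ long_K33e_ear x1 x2 y1 y2 z A a R b.
Proof.
have in_A a' : a' \in A -> a' \in x1 :: A by rewrite in_cons orbC => ->.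
have in_rA a' : a' \in A -> a' \in x2 :: rev A by rewrite in_cons mem_rev orbC => ->.
have in_x a' : a' \in A -> a' \in x1 :: x2 :: A by rewrite !in_cons => ->; rewrite !orbT.
have A_case a' R' b' : a' \in A -> b' \in x1 :: x2 :: y1 :: y2 :: z :: A ->
    ~ long_K33e_ear x1 x2 y1 y2 z A a' R' b'.
  move=> aA; rewrite !in_cons => /or4P[/eqP->|/eqP->|/eqP->|/or3P[/eqP->|/eqP->|bA]] E.
  - by apply: (no_ear_A_A aA _ E); rewrite mem_head.
  - by apply: (no_ear_A_A aA _ E); rewrite in_cons mem_head orbT.
  - exact: (no_ear_A_y1 (in_A _ aA) E).
  - exact: (no_ear_A_y1 (in_A _ aA) (long_K33e_ear_swap_y E)).
  - exact: (no_ear_A_z aA E).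
  - exact: (no_ear_A_A aA (in_x _ bA) E).
move=> av bv E; have [aA|naA] := boolP (a \in A); first exact: (A_case a R b).
have [bA|nbA] := boolP (b \in A); first exact: (A_case b (rev R) a bA av (long_K33e_ear_rev E)).
have hd1 : x1 \in x1 :: A by rewrite mem_head.
have hd2 : x2 \in x2 :: rev A by rewrite mem_head.
have E' := long_K33e_ear_rev E; have ab : a != b by case: E.
move: av bv; rewrite !in_cons (negPf naA) (negPf nbA) !orbF.
by do 2![case/or4P=> [/eqP ?|/eqP ?|/eqP ?|/orP[/eqP ?|/eqP ?]]]; subst a b;
  rewrite ?eqxx // in ab;
  first [ exact: (no_ear_x1_x2 E) | exact: (no_ear_x1_x2 E')
  | exact: (no_ear_y1_y2 E) | exact: (no_ear_y1_y2 E')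
  | exact: (no_ear_z_x1 E) | exact: (no_ear_z_x1 E')
  | exact: (no_ear_z_x1 (long_K33e_ear_swap_x E))
  | exact: (no_ear_z_x1 (long_K33e_ear_swap_x E'))
  | exact: (no_ear_z_y1 E) | exact: (no_ear_z_y1 E')
  | exact: (no_ear_z_y1 (long_K33e_ear_swap_y E))
  | exact: (no_ear_z_y1 (long_K33e_ear_swap_y E'))
  | exact: (no_ear_A_y1 hd1 E) | exact: (no_ear_A_y1 hd1 E')
  | exact: (no_ear_A_y1 hd1 (long_K33e_ear_swap_y E))
  | exact: (no_ear_A_y1 hd1 (long_K33e_ear_swap_y E'))
  | exact: (no_ear_A_y1 hd2 (long_K33e_ear_swap_x E))
  | exact: (no_ear_A_y1 hd2 (long_K33e_ear_swap_x E'))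
  | exact: (no_ear_A_y1 hd2 (long_K33e_ear_swap_y (long_K33e_ear_swap_x E)))
  | exact: (no_ear_A_y1 hd2 (long_K33e_ear_swap_y (long_K33e_ear_swap_x E')))].
Qed.

(** * Ears on [K_{2,4}] *)

(** If [b] is a middle vertex too, the ear continued through [a] to [v] is an ear from [b] to [v] on
    the theta through [b] and the two remaining middle vertices. Otherwise [b] is [u] or [v], and a
    theta through [a] and two other middle vertices has both ends on one path. *)
Lemma K24_no_ear_middle u v ws a b R :
  size ws = 4 -> uniq (u :: v :: ws ++ R) -> all (fun w => e u w && e w v) ws ->
  a \in ws -> b \in u :: v :: ws -> a != b -> link a R b ->
  (R = [::] -> ~~ has (fun w => uses u [:: w] v a b) ws) -> False.
Proof.
move=> ws4 U ews aws bws ab lR nuse.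
have nusea : R = [::] -> ~~ uses u [:: a] v a b.
  by move/nuse; apply: contra => ua; apply/hasP; exists a.
have link1 w : e u w && e w v -> link u [:: w] v by rewrite link_cons link_nil.
have buv : b \in u :: v :: ws -> b \notin ws -> b \in [:: u; v; a].
  by rewrite !inE => /or3P[->|->|->]; rewrite ?orbT.
case: (boolP (b \in ws)) => [{}bws|/(buv bws) {buv}].
  have : perm_eq ws (a :: b :: rem b (rem a ws)).
    apply: (perm_trans (perm_to_rem aws)); rewrite perm_cons perm_to_rem //.
    move: bws; rewrite (perm_mem (perm_to_rem aws)) in_cons => /orP[/eqP ba|//].
    by rewrite ba eqxx in ab.
  case: (rem b _) => [|w3 [|w4 [|? ?]]] ws_perm; move: (perm_size ws_perm); rewrite ws4 // => _.
  have {}U : uniq (u :: v :: [:: a; b; w3; w4] ++ R).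
    apply: (uniq_sub_count U) => t; rewrite /= !count_cat /=.
    by rewrite (permP ws_perm) /=; clear; lia.
  move: ews; rewrite (perm_all _ ws_perm) /= => /and5P[/andP[_ av] eb e3 e4 _].
  apply: (@no_ear_same_path u v [:: b] [:: w3] [:: w4] b v (rev (a :: R))) => //.
  - by rewrite /theta !link1 //; uniq_from U.
  - by rewrite rev_cons -cats1 link_cat link_rev lR link_nil.
  - by rewrite rev_cons -cats1; uniq_from U.
  - by rewrite inE.
  - by rewrite !inE eqxx orbT.
  - by apply/eqP => bv; move: eb; rewrite bv => /andP[_ /e_c]; case: (c v).
  by rewrite rev_cons => /(congr1 size); rewrite size_rcons.
move=> {}bws.
have ws_perm := perm_to_rem aws.
case: (rem a ws) ws_perm => [|w2 [|w3 r]] ws_perm; move: (perm_size ws_perm); rewrite ws4 // => _.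
have {}U : uniq (u :: v :: [:: a, w2, w3 & r] ++ R).
  apply: (uniq_sub_count U) => t; rewrite /= !count_cat /=.
  by rewrite (permP ws_perm) /=; clear; lia.
move: ews; rewrite (perm_all _ ws_perm) /= => /and4P[ea e2 e3 _].
apply: (@no_ear_same_path u v [:: a] [:: w2] [:: w3] a b R) => //.
- by rewrite /theta !link1 //; uniq_from U.
- by uniq_from U.
by rewrite inE.
Qed.

(** The remaining case joins [u] to [v]. Parity makes [R] odd, hence a fifth path as in
    [theta22222], possibly longer. *)
Lemma K24_no_ear u v ws a b R :
  size ws = 4 -> uniq (u :: v :: ws ++ R) -> all (fun w => e u w && e w v) ws ->
  a \in u :: v :: ws -> b \in u :: v :: ws -> a != b -> link a R b ->
  (R = [::] -> ~~ has (fun w => uses u [:: w] v a b) ws) -> False.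
Proof.
move=> ws4 U ews aws bws ab lR nuse.
have [aw|naw] := boolP (a \in ws); first exact: (K24_no_ear_middle ws4 U ews aw bws ab lR).
have [bw|nbw] := boolP (b \in ws).
  apply: (@K24_no_ear_middle u v ws b a (rev R)) => //.
  - by uniq_from U.
  - by rewrite eq_sym.
  - by rewrite link_rev.
  move=> R0; have {}R0 : R = [::] by rewrite -(revK R) R0.
  by rewrite -(eq_has (fun w => uses_comm u [:: w] v a b)) nuse.
wlog {aws naw bws nbw nuse} [au bv] : a b R U ab lR / a = u /\ b = v => [th|].
  move: aws bws; rewrite !inE (negPf naw) (negPf nbw) !orbF.
  case/orP=> /eqP ? /orP[] /eqP ?; subst a b; rewrite ?eqxx // in ab.
    exact: (th u v R).
  apply: (th u v (rev R)) => //; [by uniq_from U | by rewrite eq_sym | by rewrite link_rev].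
subst a b; move: ws4 U ews; case: ws => [|w1 [|w2 [|w3 [|w4 [|//]]]]] // _ U.
case/and5P=> /andP[a1 b1] /andP[a2 b2] /andP[a3 b3] /andP[a4 b4] _.
have oR : odd (size R) by rewrite (link_odd lR) (e_c b1) (e_c a1) negbK.
have Ups : uniq ([:: u; v] ++ flatten [:: [:: w1]; [:: w2]; [:: w3]; [:: w4]; R]) by uniq_from U.
apply: (no_certificate (v0 := u) theta22222P Ups) => //=.
rewrite !link_cons !link_nil a1 b1 a2 b2 a3 b3 a4 b4 lR oR /=.
by case: (R) oR.
Qed.

(** * Ears on a theta *)

Definition has_K24 : Prop := exists u v ws,
  [/\ size ws = 4, uniq (u :: v :: ws) & all (fun w => e u w && e w v) ws].

Definition has_long_K33e : Prop :=
  exists x1 x2 y1 y2 z A, long_K33e x1 x2 y1 y2 z A.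

Definition theta_ear u v p q r a R b : Prop :=
  [/\ theta u v p q r, 1 < (0 < size p) + (0 < size q) + (0 < size r),
      link a R b /\ a != b, uniq (u :: v :: p ++ q ++ r ++ R)
    & R = [::] -> ~~ [|| uses u p v a b, uses u q v a b | uses u r v a b]].

Lemma theta_ear_swap12 u v p q r a R b :
  theta_ear u v p q r a R b -> theta_ear u v q p r a R b.
Proof.
case=> T ne lR U nuse; split=> //; first exact: theta_swap12.
- by rewrite (addnC (nat_of_bool (0 < size q))).
- by uniq_from U.
by move/nuse; rewrite orbCA.
Qed.

Lemma theta_ear_swap23 u v p q r a R b :
  theta_ear u v p q r a R b -> theta_ear u v p r q a R b.
Proof.
case=> T ne lR U nuse; split=> //; first exact: theta_swap23.
- by rewrite addnAC.
- by uniq_from U.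
by move/nuse; rewrite [X in _ || X]orbC.
Qed.

Lemma theta_ear_rev u v p q r a R b :
  theta_ear u v p q r a R b -> theta_ear u v p q r b (rev R) a.
Proof.
case=> T ne [lR ab] U nuse; split=> //.
- by rewrite link_rev eq_sym.
- by uniq_from U.
move=> R0; have {}R0 : R = [::] by rewrite -(revK R) R0.
by rewrite (uses_comm u p) (uses_comm u q) (uses_comm u r) nuse.
Qed.

(** Since [no_ear_same_path] excludes [b] on [p] or at its ends, [b] is inner to another path. Then
    [u], [v], [a], [b] are the branch vertices of a subdivided [K_4]. *)
Lemma theta_ear_middle u v p q r a R b :
  theta_ear u v p q r a R b -> a \in p -> b \in u :: v :: p ++ q ++ r -> has_long_K33e.
Proof.
move=> + ap; have main q' r' : theta_ear u v p q' r' a R b -> b \in q' -> has_long_K33e.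
  case=> /thetaP[lp lq lr _] _ [lR _] U _ bq.
  case/splitPr: ap lp U => p1 p2; rewrite link_cat => /andP[lp1 lp2].
  case/splitPr: bq lq => q1 q2; rewrite link_cat => /andP[lq1 lq2] U.
  apply: (@K4_long_K33e u v a b r' p1 q1 (rev p2) (rev q2) R); rewrite ?link_rev //.
  by uniq_from U.
move=> E; have [T ne [lR ab] U nuse] := E.
rewrite -!cat_cons mem_cat => /orP[bp|].
  case: (@no_ear_same_path u v p q r a b R) => //.
    by move: ne; case: (p) (q) (r) => [|? ?] [|? ?] [|? ?].
  by move/nuse; rewrite negb_or => /andP[].
by rewrite mem_cat => /orP[bq|br]; [exact: main E bq | exact: main (theta_ear_swap23 E) br].
Qed.

Lemma theta_ear_branch u v p q r R : theta_ear u v p q r u R v -> has_K24.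
Proof.
case=> /thetaP[lp lq lr _] ne [lR _] U nuse.
(* If [R] is empty, the edge between [u] and [v] is new, so no path of the theta is empty. Otherwise
   [R] adds to the two nonempty paths already there. *)
have nonempty : 2 < (0 < size p) + (0 < size q) + (0 < size r) + (0 < size R).
  case: R nuse {lR U} => [/(_ erefl)|z R _] /=; last by rewrite addn1.
  by case: p {lp ne} => [|? ?]; case: q {lq} => [|? ?]; case: r {lr} => [|? ?] //=;
    rewrite /ends !eqxx ?orbT.
have [] := theta4_sizes lp lq lr lR U nonempty.
case: p lp {ne nuse nonempty} U => [|w1 []] //; case: q lq => [|w2 []] //.
case: r lr => [|w3 []] //; case: R lR => [|w4 []] //.
rewrite !link_cons !link_nil => l4 l3 l2 l1 U _ _ _ _.
exists u, v, [:: w1; w2; w3; w4]; split=> //.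
by rewrite /= l1 l2 l3 l4.
Qed.

Lemma theta_ear_step u v p q r a R b : theta_ear u v p q r a R b ->
  a \in u :: v :: p ++ q ++ r -> b \in u :: v :: p ++ q ++ r ->
  has_K24 \/ has_long_K33e.
Proof.
have main a' R' b' : theta_ear u v p q r a' R' b' -> a' \in p ++ q ++ r ->
    b' \in u :: v :: p ++ q ++ r -> has_long_K33e.
  move=> E; rewrite !mem_cat => /or3P[] av bv.
  - exact: theta_ear_middle E av bv.
  - apply: theta_ear_middle (theta_ear_swap12 E) av _.
    by move: bv; rewrite !inE !mem_cat => /or3P[->|->|/or3P[->|->|->]]; rewrite ?orbT.
  apply: theta_ear_middle (theta_ear_swap12 (theta_ear_swap23 E)) av _.
  by move: bv; rewrite !inE !mem_cat => /or3P[->|->|/or3P[->|->|->]]; rewrite ?orbT.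
move=> E av bv; have [ap|nap] := boolP (a \in p ++ q ++ r).
  by right; apply: main E ap bv.
have [bp|nbp] := boolP (b \in p ++ q ++ r).
  by right; apply: main (theta_ear_rev E) bp av.
have ab : a != b by case: E => _ _ [].
left; move: av bv; rewrite !(in_cons u) !(in_cons v) (negPf nap) (negPf nbp) !orbF.
case/orP=> /eqP ? /orP[] /eqP ?; subst a b; rewrite ?eqxx // in ab.
  exact: theta_ear_branch E.
exact: theta_ear_branch (theta_ear_rev E).
Qed.

(** * Existence of ears in a 2-connected graph *)

Section EarExistence.
Hypothesis e_2conn : two_connected e.

Lemma boundary_edge (vs : seq V) x z : x \in vs -> z \notin vs ->
  exists x' z', [/\ x' \in vs, z' \notin vs & e x' z'].
Proof.
move=> xvs zvs; have [conn _ _] := e_2conn.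
case/connectP: (conn x z) => p ep zE; rewrite {}zE in zvs.
elim: p x xvs ep zvs => [|y p IHp] x xvs /=; first by rewrite xvs.
case/andP=> exy ep zvs; have [yvs|yvs] := boolP (y \in vs); first exact: (IHp y).
by exists x, y.
Qed.

(* A shortest walk back to [vs] from an outside neighbour of [x] in the graph
   without [x] completes the ear. *)
Lemma ear_exists (vs : seq V) (E : rel V) : uniq vs -> 1 < size vs ->
  (forall x, x \in vs) /\ (forall a b, e a b -> E a b) \/
  exists a R b, [/\ a \in vs, b \in vs, link a R b /\ a != b, uniq (vs ++ R)
                   & R = [::] -> ~~ E a b].
Proof.
move=> uvs vs2; have [_ _ no_cut] := e_2conn.
have [/forallP all_vs|/forallPn[z0 z0vs]] := boolP [forall x, x \in vs].
  have [/forallP all_E|/forallPn[a /forallPn[b]]] :=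
    boolP [forall a, [forall b, e a b ==> E a b]].
    by left; split=> // a b; apply/implyP; apply/forallP: b.
  (* On a spanning [vs], an edge not recorded in [E] is itself an ear. *)
  rewrite negb_imply => /andP[ab nab]; right; exists a, [::], b; split=> //.
  - split; first by rewrite link_nil.
    by apply/eqP => ba; move: (e_c ab); rewrite ba; case: (c b).
  - by rewrite cats0.
right; have [x0 x0vs] : exists x0, x0 \in vs.
  by case: (vs) vs2 => // x0 s _; exists x0; rewrite mem_head.
have [x [z [xvs zvs xz]]] := boundary_edge x0vs z0vs.
have [y yvs yx] : exists2 y, y \in vs & y != x.
  case: (vs) vs2 uvs => [|y1 [|y2 s]] //= _ /andP[]; rewrite inE negb_or => /andP[y12 _] _.
  have [<-|] := eqVneq y1 x; last by exists y1; rewrite ?mem_head.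
  by exists y2; rewrite ?inE ?eqxx ?orbT // eq_sym.
have zx : z != x by apply: contraNneq zvs => ->.
have : connect (delete_vertex e x) z y.
  apply/negPn/negP => nzy; apply: (no_cut x); exists z, y; split=> //.
  by have [conn _ _] := e_2conn.
case/connectP=> p0 ep0 yE; case/shortenP: ep0 yE => p ep up _ yE {p0}.
have pvs : has (mem vs) p.
  apply/hasP; exists y => //; case: p yE {ep up} => [/= yz|w p ->]; last by rewrite /= mem_last.
  by move: zvs; rewrite -yz yvs.
(* Cutting at the first return [b] to [vs] keeps [p1] outside [vs]; the path avoids [x], so [b]
   differs from [x]. *)
case: (split_find pvs) ep up => b p1 p2 bvs np1; rewrite -cats1 -catA => ep up.
have [link_p bx] : link x (z :: p1) b /\ b != x.
  move: ep; rewrite cat_path /= => /and3P[ep1 /and3P[_ bx ezb] _]; split=> //.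
  rewrite link_cons xz /link rcons_path ezb andbT.
  by apply: sub_path ep1 => s t /and3P[].
exists x, (z :: p1), b; split=> //; first by rewrite eq_sym.
have uR : uniq (z :: p1) by uniq_from up.
by rewrite cat_uniq uvs uR andbT /= negb_or zvs.
Qed.

End EarExistence.

End Configurations.

(** * Isomorphisms with the listed graphs *)

(** Brings [uses] into the form, indexed by positions, in which [theta_graph] and [subdivide_edge]
    define their edges. *)
Lemma usesE (V : finType) (x0 x : V) p y a b : uses x p y a b =
  [exists j : 'I_(size p).+1,
     (nth x0 (x :: rcons p y) j == a) && (nth x0 (x :: rcons p y) j.+1 == b) ||
     (nth x0 (x :: rcons p y) j == b) && (nth x0 (x :: rcons p y) j.+1 == a)].
Proof.
have endsE z w : ends z w a b = (z == a) && (w == b) || (z == b) && (w == a).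
  by rewrite /ends !(eq_sym a) !(eq_sym b) [(w == a) && _]andbC.
elim: p x => [|z p IHp] x.
  rewrite /= endsE; apply/idP/existsP => [ab|[[[|//] ?] //]].
  by exists ord0.
rewrite [LHS]/= IHp endsE; apply/orP/existsP => [[ab|/existsP[j ab]]|[[[|j] jp] ab]].
- by exists ord0.
- by exists (lift ord0 j).
- by left.
by right; apply/existsP; exists (Ordinal (jp : j < (size p).+1)).
Qed.

Lemma isomorphic_from (V W : finType) (e : rel V) (e' : rel W) (g : W -> V) :
  injective g -> (forall v, exists w, g w = v) ->
  (forall x y, e (g x) (g y) = e' x y) -> isomorphic e e'.
Proof.
move=> g_inj g_surj g_e; have [|f gK fK] := inj_card_bij g_inj.
  rewrite -(card_codom g_inj) subset_leq_card //; apply/subsetP => v _.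
  by have [w <-] := g_surj v; apply: codom_f.
by exists f; [exists g | move=> x y; rewrite -g_e !fK].
Qed.

Lemma uniq_flatten_inj (T : eqType) (x0 : T) (ps : seq (seq T)) i j k l :
  uniq (flatten ps) -> k < size (nth [::] ps i) -> l < size (nth [::] ps j) ->
  nth x0 (nth [::] ps i) k = nth x0 (nth [::] ps j) l -> i = j /\ k = l.
Proof.
elim: ps i j => [|p ps IHps] [|i] [|j] //=; rewrite cat_uniq => /and3P[up npps ups] ki lj.
- by move/eqP; rewrite nth_uniq // => /eqP.
- move=> eq_kl; case/hasP: npps; exists (nth x0 p k); last exact: mem_nth.
  apply/flattenP; exists (nth [::] ps j); last by rewrite eq_kl mem_nth.
  by rewrite mem_nth // ltnNge; apply: contraL lj => /(nth_default [::]) ->.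
- move=> eq_kl; case/hasP: npps; exists (nth x0 p l); last exact: mem_nth.
  apply/flattenP; exists (nth [::] ps i); last by rewrite -eq_kl mem_nth.
  by rewrite mem_nth // ltnNge; apply: contraL ki => /(nth_default [::]) ->.
by move=> eq_kl; have [-> ->] := IHps i j ups ki lj eq_kl.
Qed.

Section ThetaIsomorphism.
Variables (V : finType) (e : rel V) (u v : V) (ps : seq (seq V)).
Hypothesis ps_uniq : uniq (u :: v :: flatten ps).
Hypothesis ps_all : forall x, x \in u :: v :: flatten ps.
Hypothesis ps_edges : forall a b, e a b = has (fun p => uses u p v a b) ps.
Let s := [seq (size p).+1 | p <- ps].

Let nth_s (i : 'I_(size s)) : nth 0 s i = (size (nth [::] ps i)).+1.
Proof. by rewrite (nth_map [::]) // -(size_map (fun p => (size p).+1)). Qed.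

Definition theta_point (w : theta_vertex s) : V :=
  match w with
  | inl b => if b then v else u
  | inr t => nth u (nth [::] ps (tag t)) (tagged t)
  end.

Lemma theta_point_size (i : 'I_(size s)) (k : 'I_(nth 0 s i).-1) :
  k < size (nth [::] ps i).
Proof. by have := ltn_ord k; rewrite {2}nth_s. Qed.

Lemma theta_point_flatten (t : {i : 'I_(size s) & 'I_(nth 0 s i).-1}) :
  theta_point (inr t) \in flatten ps.
Proof.
apply/flattenP; exists (nth [::] ps (tag t)); last exact: mem_nth (theta_point_size (tagged t)).
by rewrite mem_nth // -(size_map (fun p => (size p).+1)).
Qed.

Lemma theta_point_inj : injective theta_point.
Proof.
have [/= uv /andP[vps ups]] := andP ps_uniq.
move: uv; rewrite in_cons negb_or => /andP[uv nups].
have in_fl t x : x \notin flatten ps -> theta_point (inr t) <> x.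
  by move=> nx tx; move: nx; rewrite -tx theta_point_flatten.
move=> [b|t] [b'|t'] /=.
- by case: b; case: b' => // E; move: uv; rewrite E eqxx.
- by move=> E; case: (in_fl t' (if b then v else u)) => //; case: (b).
- by move=> E; case: (in_fl t (if b' then v else u)) => //; case: (b').
case: t t' => [i k] [j l] /= E.
have [ij kl] := uniq_flatten_inj ups (theta_point_size k) (theta_point_size l) E.
move/val_inj: ij => /= ij; subst j; congr inr.
by congr (Tagged _ _); apply: val_inj.
Qed.

(** One direction is a computation. For the other, some vertex of the model occupies position [j],
    and [theta_point] is injective. *)
Lemma theta_at_point (i : 'I_(size s)) j w :
  j <= (size (nth [::] ps i)).+1 ->
  theta_at i j w = (nth u (u :: rcons (nth [::] ps i) v) j == theta_point w).
Proof.
have at_point j' w' : theta_at i j' w' ->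
    nth u (u :: rcons (nth [::] ps i) v) j' = theta_point w'.
  case: w' => [[]|[i' k]] /=.
  - by move/eqP->; rewrite nth_s /= nth_rcons ltnn eqxx.
  - by move/eqP->.
  case/andP=> /eqP ii' /eqP ->; subst i'; rewrite /= nth_rcons.
  by rewrite theta_point_size.
move=> j_le; apply/idP/eqP => [/at_point //|jw].
have [w' w'j] : exists w', theta_at i j w'.
  case: j j_le {jw} => [|j]; first by exists (inl false).
  rewrite ltnS leq_eqVlt => /orP[/eqP jp|jp].
    by exists (inl true); rewrite /= nth_s jp.
  have jk : j < (nth 0 s i).-1 by rewrite nth_s.
  by exists (inr (Tagged (fun i : 'I_(size s) => 'I_(nth 0 s i).-1) (Ordinal jk))); rewrite /= !eqxx.
by rewrite -(theta_point_inj (etrans (esym (at_point _ _ w'j)) jw)).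
Qed.

Lemma isomorphic_theta : isomorphic e (theta_graph s).
Proof.
apply: (isomorphic_from theta_point_inj).
  move=> x; have := ps_all x; rewrite !inE => /or3P[/eqP->|/eqP->|].
  - by exists (inl false).
  - by exists (inl true).
  case/flattenP=> p pps xp.
  have ip : index p ps < size s by rewrite size_map index_mem.
  have kp : index x p < (nth 0 s (Ordinal ip)).-1.
    by rewrite nth_s /= nth_index // index_mem.
  exists (inr (Tagged (fun i : 'I_(size s) => 'I_(nth 0 s i).-1) (Ordinal kp))) => /=.
  by rewrite nth_index // nth_index.
move=> x y; rewrite ps_edges; apply/hasP/existsP => [[p pps]|[i]].
  have ip : index p ps < size s by rewrite size_map index_mem.
  have nip : nth [::] ps (Ordinal ip) = p by rewrite /= nth_index.
  rewrite (usesE u) => /existsP[j xy]; exists (Ordinal ip); apply/existsP.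
  have jp : j < nth 0 s (Ordinal ip) by rewrite nth_s nip.
  exists (Ordinal jp); have jp' := ltn_ord j.
  by rewrite !theta_at_point nip // ltnW.
case/existsP=> j; have jp : j < (size (nth [::] ps i)).+1 by rewrite -nth_s.
rewrite !theta_at_point // 1?ltnW // => xy.
exists (nth [::] ps i); first by rewrite mem_nth // -(size_map (fun p => (size p).+1)).
by rewrite (usesE u); apply/existsP; exists (Ordinal jp).
Qed.

End ThetaIsomorphism.

Lemma isomorphic_cycle (V : finType) (e : rel V) (x : V) (p : seq V) :
  uniq (x :: p) -> (forall y, y \in x :: p) ->
  (forall a b, e a b = (b == next (x :: p) a) || (a == next (x :: p) b)) ->
  isomorphic e (cycle_graph (size p).+1).
Proof.
move=> up all_p e_next.
pose g (i : 'I_(size p).+1) := nth x (x :: p) i.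
have gS i : next (x :: p) (g i) = g (ordS i).
  rewrite next_nth mem_nth // /g index_uniq // /=.
  have [ip|ip] := ltnP i (size p); first by rewrite modn_small.
  have -> : i = size p :> nat by have := ltn_ord i; lia.
  (* At the last vertex [nth] falls back to its default, the head of the cycle, just as [ordS] wraps
     to 0. *)
  by rewrite modnn nth_default.
have g_inj : injective g.
  by move=> i j /eqP; rewrite /g nth_uniq // => /eqP/val_inj.
apply: (isomorphic_from g_inj) => [y|i j].
  have yi : index y (x :: p) < (size p).+1 by rewrite index_mem.
  by exists (Ordinal yi); rewrite /g nth_index.
by rewrite e_next !gS !(inj_eq g_inj).
Qed.

(** Here [a0] and [z] are the vertices of degree 2 left by the deleted edge, and [A] subdivides the
    edge between [a0] and [x2]. *)
Lemma isomorphic_long_K33e (V : finType) (e : rel V) (x1 x2 y1 y2 z a0 : V) (A : seq V) :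
  uniq (x1 :: x2 :: y1 :: y2 :: z :: a0 :: A) ->
  (forall x, x \in x1 :: x2 :: y1 :: y2 :: z :: a0 :: A) ->
  (forall a b, e a b = uses_long_K33e x1 x2 y1 y2 z (a0 :: A) a b) ->
  exists (u v : bool * 'I_3) (k : nat),
    [/\ K33_minus_edge u v, degree K33_minus_edge u = 2 &
        isomorphic e (subdivide_edge K33_minus_edge u v k)].
Proof.
move=> U all_x e_uses.
exists (true, ord0), (false, ord_max), (size A); split=> //.
  rewrite /degree (_ : [set w | _] = [set (false, lift ord0 ord0); (false, ord_max)]).
    by rewrite cards2.
  by apply/setP => -[[] [[|[|[|//]]] i3]]; rewrite !inE.
pose corner (w : bool * 'I_3) : V :=
  nth x1 (if w.1 then [:: a0; y1; y2] else [:: z; x1; x2]) w.2.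
pose g (w : (bool * 'I_3) + 'I_(size A)) : V :=
  match w with inl c => corner c | inr i => nth x1 A i end.
(* In this order the vertices of the two sides take positions 0 to 2 and 3 to 5, and the subdividing
   vertices start at 6, so injectivity of [g] is arithmetic on positions. *)
have corner_uniq : uniq ([:: a0; y1; y2] ++ [:: z; x1; x2] ++ A) by uniq_from U.
have cornerE w : corner w = nth x1 ([:: a0; y1; y2] ++ [:: z; x1; x2] ++ A) (if w.1 then val w.2 else 3 + w.2).
  by case: w => [[] [[|[|[|//]]] ?]].
have gE w : g w = nth x1 ([:: a0; y1; y2] ++ [:: z; x1; x2] ++ A)
   (match w with inl c => if c.1 then val c.2 else 3 + c.2 | inr i => 6 + i end).
  by case: w => [w|i] /=; rewrite ?cornerE.
have g_inj : injective g.
  move=> w w'; rewrite !gE => /eqP; rewrite nth_uniq //; last 2 first.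
  - by case: w => [[[] [i i3]]|[i iA]] /=; lia.
  - by case: w' => [[[] [i i3]]|[i iA]] /=; lia.
  move/eqP; case: w => [[b i]|i]; case: w' => [[b' i']|i'] /=.
  - have := ltn_ord i; have := ltn_ord i'; move=> i'3 i3.
    by case: b; case: b' => ii'; try lia; congr (inl (_, _)); apply: val_inj => /=; lia.
  - by have := ltn_ord i; case: b; lia.
  - by have := ltn_ord i'; case: b'; lia.
  by move=> ii'; congr inr; apply: val_inj => /=; lia.
apply: (isomorphic_from g_inj) => [x|w w'].
  have := all_x x; rewrite 6!in_cons.
  have xA : x \in A -> exists w, g w = x.
    move=> xA; have i_lt : index x A < size A by rewrite index_mem.
    by exists (inr (Ordinal i_lt)); rewrite /= nth_index.
  case/or4P=> [/eqP->|/eqP->|/eqP->|/or4P[/eqP->|/eqP->|/eqP->|/xA //]].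
  - by exists (inl (false, @Ordinal 3 1 isT)).
  - by exists (inl (false, @Ordinal 3 2 isT)).
  - by exists (inl (true, @Ordinal 3 1 isT)).
  - by exists (inl (true, @Ordinal 3 2 isT)).
  - by exists (inl (false, @Ordinal 3 0 isT)).
  - by exists (inl (true, @Ordinal 3 0 isT)).
have subE j w0 : j <= (size A).+1 ->
    subdivided_at (true, ord0) (false, ord_max) j w0 =
    (nth x1 (a0 :: rcons A x2) j == g w0) :> bool.
  have at_point j' t : subdivided_at (true, ord0) (false, ord_max) j' t ->
      nth x1 (a0 :: rcons A x2) j' = g t.
    case: t => [t|i] /=.
      case/orP=> /andP[/eqP-> /eqP->] //.
      by rewrite /= nth_rcons ltnn eqxx.
    by move/eqP->; rewrite /= nth_rcons ltn_ord.
  move=> j_le; apply/idP/eqP => [/at_point //|jw].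
  have [w1 w1j] : exists w1 : (bool * 'I_3) + 'I_(size A),
      subdivided_at (true, ord0) (false, ord_max) j w1.
    case: j j_le {jw} => [|j]; first by exists (inl (true, ord0)).
    rewrite ltnS leq_eqVlt => /orP[/eqP jA|jA].
      by exists (inl (false, ord_max)); rewrite /= jA !eqxx ?orbT.
    by exists (inr (Ordinal jA)); rewrite /= eqxx.
  by rewrite -(g_inj _ _ (etrans (esym (at_point _ _ w1j)) jw)).
have pathE : uses a0 A x2 (g w) (g w') =
    [exists j : 'I_(size A).+1,
      subdivided_at (true, ord0) (false, ord_max) j w &&
      subdivided_at (true, ord0) (false, ord_max) j.+1 w' ||
      subdivided_at (true, ord0) (false, ord_max) j w' &&
      subdivided_at (true, ord0) (false, ord_max) j.+1 w].
  rewrite (usesE x1); apply: eq_existsb => j; have jA := ltn_ord j.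
  by rewrite !subE // ltnW.
have endsE t t' : ends (g t) (g t') (g w) (g w') = ends t t' w w'.
  by rewrite /ends !(inj_eq g_inj).
pose b0 : (bool * 'I_3) + 'I_(size A) := inl (true, @Ordinal 3 0 isT).
pose b1 : (bool * 'I_3) + 'I_(size A) := inl (true, @Ordinal 3 1 isT).
pose b2 : (bool * 'I_3) + 'I_(size A) := inl (true, @Ordinal 3 2 isT).
pose c0 : (bool * 'I_3) + 'I_(size A) := inl (false, @Ordinal 3 0 isT).
pose c1 : (bool * 'I_3) + 'I_(size A) := inl (false, @Ordinal 3 1 isT).
pose c2 : (bool * 'I_3) + 'I_(size A) := inl (false, @Ordinal 3 2 isT).
have -> : e (g w) (g w') = [|| ends c1 b1 w w' || ends b1 c2 w w',
    ends c1 b2 w w' || ends b2 c2 w w', ends c1 b0 w w' || uses a0 A x2 (g w) (g w')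
  | ends b1 c0 w w' || ends c0 b2 w w'].
  by rewrite e_uses /uses_long_K33e -!endsE.
rewrite pathE /subdivide_edge /=; move: [exists j, _] => P.
case: w w' {endsE pathE} => [[a [i i3]]|i] [[a' [i' i'3]]|i']; rewrite /ends /=.
- by case: a; case: a'; case: i i3 => [|[|[|//]]] i3; case: i' i'3 => [|[|[|//]]] i'3;
    case: P.
- by rewrite !andbF !orbF.
- by rewrite !orbF.
by rewrite !orbF.
Qed.

(** * Growing from an edge to the whole graph *)

Section EarDecomposition.
Variables (V : finType) (e : rel V).
Hypothesis e_sym : symmetric e.
Hypothesis e_2conn : two_connected e.
Hypothesis e_chos : choosable 4 2 e.
Variable c : V -> bool.
Hypothesis e_c : forall x y, e x y -> c y = ~~ c x.
Notation link := (link e).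
Let link_odd := link_odd e_c.
Let link_rev := link_rev e_sym.
Let uses_e := @uses_link V e e_sym.
Let ear_exists := ear_exists e_c e_2conn.

Definition exceptional : Prop :=
  (exists s t : nat, [/\ 0 < s, 0 < t &
        [\/ isomorphic e (cycle_graph (2 * s)),
            isomorphic e (theta_graph [:: 2; 2 * s; 2 * t]),
            isomorphic e (theta_graph [:: 1; 2 * s + 1; 2 * t + 1])
          | isomorphic e (theta_graph [:: 2; 2; 2; 2])]])
  \/
  (exists (u v : bool * 'I_3) (k : nat),
        [/\ K33_minus_edge u v, degree K33_minus_edge u = 2 &
            isomorphic e (subdivide_edge K33_minus_edge u v k)]).

(** No ear fits, so [ear_exists] makes the configuration the whole graph; [A] is odd, so it has the
    first vertex needed for the isomorphism. *)
Lemma long_K33e_exceptional : has_long_K33e e -> exceptional.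
Proof.
case=> x1 [x2 [y1 [y2 [z [A D]]]]]; right.
have := D; case/andP=> /and4P[a1 a2 a3 a4] /and5P[a5 a6 a7 a8 U].
case: (ear_exists (uses_long_K33e x1 x2 y1 y2 z A) U isT) => [[all_x all_e]|]; last first.
  case=> a [R [b [av bv [lR ab] UR nuse]]].
  case: (long_K33e_no_ear e_sym e_chos e_c av bv (R := R)); split=> //.
case: A a7 a8 {D} U all_x all_e => [|a0 A] // a7 _ U all_x all_e.
apply: (isomorphic_long_K33e U all_x) => a b; apply/idP/idP => [/all_e //|].
case/or4P; apply: uses_e => //; rewrite link_cons link_nil.
- by rewrite a1 e_sym a3.
- by rewrite a2 e_sym a4.
by rewrite a5 a6.
Qed.

Lemma K24_exceptional : has_K24 e -> exceptional.
Proof.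
case=> u [v [ws [ws4 U ews]]]; left; exists 1, 1; split=> //; constructor 4.
pose ps := [seq [:: w] | w <- ws].
have fps : flatten ps = ws by rewrite /ps; elim: (ws) => //= w s ->.
have hasE a b : has (fun w => uses u [:: w] v a b) ws = has (fun p => uses u p v a b) ps.
  by rewrite /ps has_map.
case: (ear_exists (fun a b => has (fun w => uses u [:: w] v a b) ws) U isT) => [[all_x all_e]|]; last first.
  case=> a [R [b [av bv [lR ab] UR nuse]]].
  by case: (K24_no_ear e_sym e_chos e_c ws4 UR ews av bv ab lR nuse).
have -> : [:: 2; 2; 2; 2] = [seq (size p).+1 | p <- ps].
  by rewrite /ps; case: (ws) ws4 => [|? [|? [|? [|? []]]]].
apply: (@isomorphic_theta V e u v ps); rewrite ?fps // => a b; rewrite -hasE.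
apply/idP/idP => [/all_e //|/hasP[w /(allP ews) w_e]]; apply: uses_e.
by rewrite link_cons link_nil.
Qed.

Lemma theta_exceptional u v p q r : theta e u v p q r ->
  1 < (0 < size p) + (0 < size q) + (0 < size r) -> exceptional.
Proof.
move=> T ne; have [/thetaP[lp lq lr U] /theta_short-/(_ e_chos c e_c)] := (T, T).
pose E a b := [|| uses u p v a b, uses u q v a b | uses u r v a b].
case: (ear_exists E U isT) => [[all_x all_e]|]; last first.
  case=> a [R [b [av bv [lR ab] UR nuse]]] _.
  have te : theta_ear e u v p q r a R b by split=> //; uniq_from UR.
  case: (theta_ear_step e_sym e_chos e_c te av bv).
    exact: K24_exceptional.
  exact: long_K33e_exceptional.
have {all_e} e_E a b : e a b = E a b.
  apply/idP/idP => [/all_e //|]; rewrite /E => /or3P[]; exact: uses_e.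
have := link_odd lr; rewrite -(link_odd lp); have := link_odd lq; rewrite -(link_odd lp).
have main p' q' r' : uniq (u :: v :: p' ++ q' ++ r') ->
    (forall x, x \in u :: v :: p' ++ q' ++ r') ->
    (forall a b, e a b = [|| uses u p' v a b, uses u q' v a b | uses u r' v a b]) ->
    odd (size q') = odd (size p') -> odd (size r') = odd (size p') ->
    1 < (0 < size p') + (0 < size q') + (0 < size r') -> size p' <= 1 -> exceptional.
  move=> U' all' e' oq or ne' p1; left.
  (* Half the path length, rounded down, gives [s] and [t] in both families: the lengths are
     [2 * s + 1] and [2 * t + 1] if [p'] is an edge, and [2 * s] and [2 * t] if it has one inner
     vertex. *)
  exists (size q').+1./2, (size r').+1./2.
  have I : isomorphic e (theta_graph [:: (size p').+1; (size q').+1; (size r').+1]).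
    apply: (@isomorphic_theta V e u v [:: p'; q'; r']); rewrite /= ?cats0 //.
    by move=> a b; rewrite e' orbF.
  have [p0|p0] := posnP (size p').
    rewrite p0 /= in oq or ne' I; split; [size_lia | size_lia |].
    by constructor 3; move: I; congr (isomorphic e (theta_graph [:: _; _; _])); size_lia.
  have {}p0 : size p' = 1 by size_lia.
  rewrite p0 /= in oq or ne' I; split; [size_lia | size_lia |].
  by constructor 2; move: I; congr (isomorphic e (theta_graph [:: _; _; _])); size_lia.
move=> oq or /or3P[p1|q1|r1].
- exact: (main p q r).
- apply: (main q p r) => //.
  + by uniq_from U.
  + by move=> x; move: (all_x x); rewrite !inE !mem_cat => /or3P[->|->|/or3P[->|->|->]]; rewrite ?orbT.
  + by move=> a b; rewrite e_E /E orbCA.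
  + by rewrite or oq.
  by move: ne; do 3![case: (0 < size _)].
apply: (main r p q) => //.
- by uniq_from U.
- by move=> x; move: (all_x x); rewrite !inE !mem_cat => /or3P[->|->|/or3P[->|->|->]]; rewrite ?orbT.
- by move=> a b; rewrite e_E /E [X in _ || X]orbC orbCA.
- by rewrite or oq.
by move: ne; do 3![case: (0 < size _)].
Qed.

Lemma cycle_exceptional x y p :
  link x (y :: p) x -> uniq (x :: y :: p) -> 0 < size p -> exceptional.
Proof.
move=> lx U p0; pose s := x :: y :: p.
have cyc : cycle e s by [].
have E_e a b : b == next s a -> a \in s -> e a b by move=> /eqP-> /(next_cycle cyc).
case: (ear_exists (fun a b => (b == next s a) || (a == next s b)) U isT) => [[all_x all_e]|].
  left; exists (size p).+2./2, 1; split=> //; constructor 1.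
  have -> : 2 * (size p).+2./2 = (size (y :: p)).+1.
    by have := link_odd lx; rewrite eqxx /=; lia.
  apply: (isomorphic_cycle U all_x) => a b; apply/idP/idP => [/all_e //|].
  case/orP=> E; first exact: E_e E (all_x a).
  by rewrite e_sym; apply: E_e E (all_x b).
case=> a [R [b [av bv [lR ab] UR nuse]]].
(* Rotating the cycle to start at [a] splits it at [b] into two arcs, which form a theta together
   with the ear. *)
case: (rot_to_arc U av bv ab) => i p1 p2 _ _ rot_i.
have Urot : uniq (a :: p1 ++ b :: p2) by rewrite -rot_i rot_uniq.
have : cycle e (a :: p1 ++ b :: p2) by rewrite -rot_i rot_cycle.
rewrite /= rcons_cat /= -/(link a _ a) -rcons_cons -rcons_cat => lap.
have {lap} : link a (p1 ++ b :: p2) a by [].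
rewrite link_cat => /andP[l1 l2].
have sE : next s =1 next (a :: p1 ++ b :: p2) by move=> w; rewrite -rot_i next_rot.
apply: (@theta_exceptional a b p1 (rev p2) R).
  rewrite /theta l1 lR link_rev l2.
  have U' : uniq (s ++ R) by [].
  apply: (uniq_sub_count U') => w; rewrite [X in _ <= X]count_cat -(permP (permEl (perm_rot i s))) rot_i.
  by rewrite /= ?(count_cat, count_rev) /= ?(count_cat, count_rev) /=; clear; lia.
(* A nonempty [R] needs one nonempty arc, which exists because the cycle has at least three
   vertices. An empty [R] is a chord, so neither arc is empty. *)
rewrite size_rev; case: R nuse {lR UR} => [/(_ erefl)|? ? _]; last first.
  have : size (rot i s) = (size p).+2 by rewrite size_rot.
  by rewrite rot_i /= size_cat /=; move: p0; clear; lia.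
rewrite !sE negb_or => /andP[ab1 ba1].
have p1_0 : 0 < size p1.
  by case: (p1) ab1 => //=; rewrite !eqxx.
have p2_0 : 0 < size p2.
  case: (p2) ba1 Urot => // + Urot; rewrite -(next_rot (size (a :: p1)) Urot).
  by rewrite -cat_cons rot_size_cat /= !eqxx.
by rewrite p1_0 p2_0.
Qed.

(** The growth starts from a single edge. A third vertex forces an ear on it, and since that edge is
    already recorded the ear has inner vertices and closes a cycle. *)
Lemma two_connected_exceptional : exceptional.
Proof.
have [conn card_V _] := e_2conn.
have [x [y xy]] : exists x y : V, x != y.
  case: (pickP (fun t : V * V => t.1 != t.2)) => [[x y] xy|no]; first by exists x, y.
  have : #|V| <= 1 by apply/fintype_le1P => x y; move: (no (x, y)) => /= /negbFE/eqP ->.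
  lia.
have [z xz] : exists z, e x z.
  case/connectP: (conn x y) => -[|z p] /=; first by move=> _ yx; rewrite yx eqxx in xy.
  by case/andP=> xz _ _; exists z.
have zx : x != z by apply/eqP => zx; move: (e_c xz); rewrite -zx; case: (c x).
have U : uniq [:: x; z] by rewrite /= inE zx.
case: (ear_exists (ends x z) U isT) => [[all_x _]|].
  have : #|V| <= size [:: x; z].
    by rewrite cardE; apply: uniq_leq_size (enum_uniq V) _ => w _; apply: all_x.
  by rewrite leqNgt card_V.
case=> a [R [b [av bv [lR ab] UR nuse]]].
have R0 : R <> [::].
  move=> R0; move: av bv; rewrite !inE => /orP[] /eqP ? /orP[] /eqP ?; subst a b;
    by move: (nuse R0) ab; rewrite /ends !eqxx ?orbT.
wlog {av bv nuse ab} [ax bz] : a b R lR UR R0 / a = x /\ b = z => [th|].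
  move: av bv; rewrite !inE => /orP[] /eqP ? /orP[] /eqP ?; subst a b;
    rewrite ?eqxx // in ab.
    exact: (th x z R).
  apply: (th x z (rev R)); rewrite ?link_rev //; first by uniq_from UR.
  by move=> rR; apply: R0; rewrite -(revK R) rR.
subst a b; case: R R0 lR UR => // w R _ lR UR.
apply: (@cycle_exceptional z x (w :: R)) => //.
  by rewrite link_cons e_sym xz.
by uniq_from UR.
Qed.

End EarDecomposition.

Theorem theorem9 (V : finType) (e : rel V)
    (e_sym : symmetric e) (e_irr : irreflexive e)
    (e_2conn : two_connected e) :
  ~ ((exists s t : nat, [/\ 0 < s, 0 < t &
        [\/ isomorphic e (cycle_graph (2 * s)),
            isomorphic e (theta_graph [:: 2; 2 * s; 2 * t]),
            isomorphic e (theta_graph [:: 1; 2 * s + 1; 2 * t + 1])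
          | isomorphic e (theta_graph [:: 2; 2; 2; 2])]])
     \/
     (exists (u v : bool * 'I_3) (k : nat),
        [/\ K33_minus_edge u v, degree K33_minus_edge u = 2 &
            isomorphic e (subdivide_edge K33_minus_edge u v k)])) ->
  ~ choosable 4 2 e.
Proof.
move=> not_exceptional e_chos; apply: not_exceptional.
have [c e_c] := choosable_bipartite e_chos.
exact: (two_connected_exceptional e_sym e_2conn e_chos e_c).
Qed.
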